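(* For every function $f\in L^2(\mathbb{T})$ we have $$\frac{1}{2\pi}\left|\left\{\xi\in\mathbb{T} : \mathcal{H}^{\mathbb{T}}f(\xi)\geq 1\right\}\right| \leq \frac{\|f\|_2^2}{1+\|f\|_2^2}.$$ Moreover, for every $m\in[0,1)$ there exists a function $f\in L^2(\mathbb{T})$ for which both sides of this inequality are equal to $m$.
   Context: $\mathbb{T}$ is the unit circle in $\mathbb{C}$, $|A|$ denotes the arc-length measure of $A\subset\mathbb{T}$ (so $|\mathbb{T}|=2\pi$). Functions are real-valued, and $\|f\|_p$ is the $L^p$-norm with respect to the normalized Haar measure on $\mathbb{T}$, i.e. $\|f\|_p^p=\frac1{2\pi}\int_{-\pi}^{\pi}|f(e^{is})|^p\,ds$. The Hilbert transform on the circle is the singular integral (defined for almost every $t$) $$\mathcal{H}^{\mathbb{T}}f(e^{it})=\frac1{2\pi}\,\mathrm{p.v.}\int_{-\pi}^{\pi}f(e^{is})\cot\frac{t-s}{2}\,ds,\qquad f\in L^1(\mathbb{T}).$$ *)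

(* Defs.v *)
From HB Require Import structures.
From mathcomp Require Import all_boot all_order all_algebra.
From mathcomp Require Import all_classical all_reals all_analysis measurable_realfun.
From mathcomp Require Import complex.

Set Implicit Arguments.
Unset Strict Implicit.
Unset Printing Implicit Defensive.

Import Order.TTheory GRing.Theory Num.Theory.
Import numFieldNormedType.Exports.

Local Open Scope classical_set_scope.
Local Open Scope ring_scope.
Local Open Scope complex_scope.

Definition circle (R : realType) : Type := {z : R[i] | `|z| == 1}.

Section circle.
Context {R : realType}.
Implicit Types (z xi : circle R) (t s : R).

Fact norm_cos_sin t : `|cos t +i* sin t| == 1.
Proof. by rewrite normc_def /= cos2Dsin2 sqrtr1. Qed.

(* expi t is the point e^{it}. *)
Definition expi t : circle R := exist _ (cos t +i* sin t) (norm_cos_sin t).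

HB.instance Definition _ := gen_eqMixin (circle R).
HB.instance Definition _ := gen_choiceMixin (circle R).
HB.instance Definition _ := isPointed.Build (circle R) (expi 0).

Definition circle_coord z : R * R := (complex.Re (sval z), complex.Im (sval z)).

(* The sigma-algebra induced by the Borel sets of the plane. *)
HB.instance Definition _ := Measurable.copy (circle R)
  (g_sigma_algebra_preimageType circle_coord).

Fact measurable_expi : measurable_fun setT expi.
Proof.
move=> _ _ [B mB <-]; rewrite setTI -comp_preimage.
have mcs : measurable_fun setT (fun t : R => (cos t, sin t)).
  apply: measurable_fun_pair; apply: continuous_measurable_fun.
    exact: continuous_cos.
  exact: continuous_sin.
exact: mcs.
Qed.

(* On nonmeasurable sets this is the outer measure, as is lebesgue_measure. *)
Definition arclength : set (circle R) -> \bar R :=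
  pushforward (mrestr lebesgue_measure (measurable_itv `]- pi, pi : R])) expi.

HB.instance Definition _ := Measure.copy arclength
  (measure_function_pushforward__canonical__measure_function_Measure
    (mrestr lebesgue_measure (measurable_itv `]- pi, pi : R])) measurable_expi).

Fact inv_2pi_ge0 : 0 <= (2 * pi : R)^-1.
Proof. by rewrite invr_ge0 mulr_ge0 // pi_ge0. Qed.

Definition haar : set (circle R) -> \bar R :=
  mscale (NngNum inv_2pi_ge0) arclength.

HB.instance Definition _ := Measure.on haar.

Definition L2norm (f : circle R -> R) : R :=
  fine ('N[haar]_2%:E[EFin \o f]).

Definition arg xi : R := xget 0 [set t | t \in `]- pi, pi] /\ expi t = xi].

Definition cot (x : R) : R := cos x / sin x.

(* The principal value removes a symmetric arc around xi, of chordal radius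
   eps; the choice of arg xi is immaterial since cot is pi-periodic. *)
Definition truncated_hilbert (eps : R) (f : circle R -> R) xi : R :=
  (2 * pi)^-1 * \int[lebesgue_measure]_(s in
    [set s | s \in `[- pi, pi] /\ eps %:C < `|sval xi - sval (expi s)|])
    (f (expi s) * cot ((arg xi - s) / 2)).

(* Meaningful where the limit exists, hence almost everywhere for integrable
   f; elsewhere lim takes an arbitrary value. *)
Definition hilbert (f : circle R -> R) xi : R :=
  lim (truncated_hilbert eps f xi @[eps --> 0^'+]).

End circle.

(* Main.v *)
(* Let H_e be the operator of convolution with the cotangent kernel truncated
   at chordal distance e. The identity
     cot a cot b + 1 = cot (a - b) (cot b - cot a)
   shows that the sum of the Gram kernels of the truncated cotangent and of the
   truncation itself is pointwise nonnegative; since the truncated cotangent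
   has mean zero, Schur's test gives that every H_e is a contraction of L2, and
   H_e f has mean zero. Cantelli's inequality for H_e f and Fatou's lemma for
   sets along e = 1/n then give the inequality.

   For sharpness, let u be 1 on an arc of normalized length m and -m/(1 - m)
   elsewhere, and f = - lim_e H_e u, a limit that is attained for small e away
   from the endpoints of the arc. The same cotangent identity gives
   H_e H_d u -> - u as e, d -> 0, so the Hilbert transform of f is u off the
   endpoints. Contraction and Fatou's lemma bound |f|_2^2 by |u|_2^2 = m/(1 - m),
   and the inequality applied to f provides the reverse bound. *)
From HB Require Import structures.
Require Import Defs.
From mathcomp Require Import all_boot all_order all_algebra.
From mathcomp Require Import all_classical all_reals all_analysis measurable_realfun.
From mathcomp Require Import ring lra complex.
Import Order.TTheory GRing.Theory Num.Theory.
Import numFieldNormedType.Exports.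
Local Open Scope classical_set_scope.
Local Open Scope ring_scope.
Set Implicit Arguments.
Unset Strict Implicit.
Unset Printing Implicit Defensive.

(** * Integral operators on a probability space *)

Section probability_integrals.
Context d (T : measurableType d) (R : realType) (P : probability T R).
Implicit Types f g h : T -> R.

Local Notation integ f := (P.-integrable setT (EFin \o f)).

(** The cotangent identity serves twice for one reason: when a product of two cotangent kernels is
    integrated over the middle point, the sum or difference of the two half-angles does not depend
    on that point. Its cotangent leaves the integral, and integrals with a single truncated
    cotangent remain. In the Gram kernel they combine into an integrand of one sign; in H_e H_d they
    are errors of the size of the removed arcs, so that the composed kernel tends to 1 off the
    diagonal. The minus sign in H_e H_d u -> - u comes from the mean: kernels of mean zero only see
    u(y) - u(t), whose integral in y is - u(t). Truncated kernels are bounded, so every exchange of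
    integrals is plain Fubini. The price is paid in the inversion: with e fixed, the kernel bound
    2/e calls for L1 convergence of H_d u, and d tends to 0 before e. A limit that is at least 1
    only puts H_e f above 1 - r for small e. Cantelli is therefore applied at level 1 - r, and r is
    removed at the end. *)

Lemma integ_measurable f : integ f -> measurable_fun setT f.
Proof. by move=> /measurable_int /measurable_EFinP. Qed.

Lemma integ_dominated f g : measurable_fun setT f -> integ g ->
  (forall x, `|f x| <= g x) -> integ f.
Proof.
move=> mf ig fg; apply: (le_integrable measurableT _ _ ig).
  exact/measurable_EFinP.
by move=> x _ /=; rewrite lee_fin (le_trans (fg x))// ler_norm.
Qed.

Lemma integ_cst c : integ (fun=> c).
Proof. exact: finite_measure_integrable_cst. Qed.

Lemma integ_bounded f (M : R) : measurable_fun setT f ->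
  (forall x, `|f x| <= M) -> integ f.
Proof. by move=> mf fM; exact: (integ_dominated mf (integ_cst M) fM). Qed.

Lemma integD f g : integ f -> integ g -> integ (fun x => f x + g x).
Proof. by move=> fi gi; have := integrableD measurableT fi gi. Qed.

Lemma integZ c f : integ f -> integ (fun x => c * f x).
Proof. by move=> fi; have := integrableZl measurableT c fi. Qed.

Lemma integB f g : integ f -> integ g -> integ (fun x => f x - g x).
Proof. by move=> fi gi; have := integrableB measurableT fi gi. Qed.

Lemma integ_norm f : integ f -> integ (fun x => `|f x|).
Proof. by move=> fi; have := integrable_norm fi. Qed.

Lemma integM_bounded f h (M : R) : measurable_fun setT h ->
  (forall x, `|h x| <= M) -> integ f -> integ (fun x => h x * f x).
Proof.
move=> mh hM fi; have fm := integ_measurable fi.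
apply: (integ_dominated _ (integZ M (integ_norm fi))).
  exact: measurable_funM.
by move=> x; rewrite normrM ler_wpM2r.
Qed.

Lemma probability_Rintegral_cst (c : R) : \int[P]_x c = c.
Proof. by rewrite Rintegral_cst// [X in fine X](probability_setT P) mulr1. Qed.

Lemma le_norm_Rintegral f (M : R) : integ f -> (forall x, `|f x| <= M) ->
  `|\int[P]_x f x| <= M.
Proof.
move=> fi fM; apply: (le_trans (le_normr_Rintegral measurableT fi)).
rewrite -[leRHS]probability_Rintegral_cst.
apply: le_Rintegral => //; first exact: integ_norm.
exact: integ_cst.
Qed.

Definition square_integrable f :=
  measurable_fun setT f /\ integ (fun x => f x ^+ 2).

Lemma square_integrableM f g : square_integrable f -> square_integrable g ->
  integ (fun x => f x * g x).
Proof.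
move=> [mf fi] [mg gi]; apply: (integ_dominated _ (integD fi gi)).
  exact: measurable_funM.
move=> x; rewrite ler_norml; apply/andP; split.
  rewrite lerNl -subr_ge0.
  have -> : f x ^+ 2 + g x ^+ 2 - - (f x * g x) =
    ((f x + g x) ^+ 2 + (f x ^+ 2 + g x ^+ 2)) / 2 by field.
  by rewrite divr_ge0// !addr_ge0// sqr_ge0.
rewrite -subr_ge0.
have -> : f x ^+ 2 + g x ^+ 2 - f x * g x =
  ((f x - g x) ^+ 2 + (f x ^+ 2 + g x ^+ 2)) / 2 by field.
by rewrite divr_ge0// !addr_ge0// sqr_ge0.
Qed.

Lemma square_integrable_bounded f (M : R) : measurable_fun setT f ->
  (forall x, `|f x| <= M) -> square_integrable f.
Proof.
move=> mf fM; split => //; apply: (integ_bounded (M := M ^+ 2)).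
  exact: measurable_funX.
by move=> x; rewrite normrX lerXn2r// nnegrE (le_trans _ (fM x)).
Qed.

Lemma square_integrable_integ f : square_integrable f -> integ f.
Proof.
move=> sf.
have s1 : square_integrable (fun=> 1 : R).
  by apply: (square_integrable_bounded (M := 1)) => // x; rewrite normr1.
have := square_integrableM sf s1; apply: eq_integrable => // x _ /=.
by rewrite mulr1.
Qed.

Lemma square_integrableB f g : square_integrable f -> square_integrable g ->
  square_integrable (fun x => f x - g x).
Proof.
move=> sf sg; split; first by apply: measurable_funB; [case: sf|case: sg].
have := integD (integB (proj2 sf) (integZ 2 (square_integrableM sf sg))) (proj2 sg).
by apply: eq_integrable => // x _ /=; congr EFin; ring.
Qed.

End probability_integrals.

Section integral_operator.
Context d1 d2 (T1 : measurableType d1) (T2 : measurableType d2) (R : realType).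
Context (P1 : probability T1 R) (P2 : probability T2 R).
Variables (B : T1 * T2 -> R) (C : R).
Hypothesis mB : measurable_fun setT B.
Hypothesis BC : forall z, `|B z| <= C.

Lemma integ_kernel h x : P2.-integrable setT (EFin \o h) ->
  P2.-integrable setT (EFin \o (fun y => B (x, y) * h y)).
Proof.
move=> hi; apply: (@integM_bounded _ _ _ _ _ _ C) => //.
exact: measurable_fun_pair2.
Qed.

(** Tonelli's criterion: the inner absolute integral at x is at most C |h|_1 |g x|, which is
    integrable in x. *)
Lemma integ_bilinear g h :
  P1.-integrable setT (EFin \o g) -> P2.-integrable setT (EFin \o h) ->
  (P1 \x P2)%E.-integrable setT
    (EFin \o (fun z => g z.1 * (B z * h z.2))).
Proof.
move=> gi hi.
have mg := integ_measurable gi; have mh := integ_measurable hi.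
have mF : measurable_fun setT
    (EFin \o (fun z : T1 * T2 => g z.1 * (B z * h z.2))).
  apply/measurable_EFinP; apply: measurable_funM.
    exact: (measurableT_comp mg measurable_fst).
  by apply: measurable_funM => //; exact: (measurableT_comp mh measurable_snd).
apply/(integrable12ltyP _ _ mF) => /=.
have C0 : 0 <= C by apply: (le_trans _ (BC (point, point))).
have [_ Ig] := integrableP _ _ _ gi; have [_ Ih] := integrableP _ _ _ hi.
set I := (\int[P2]_y `|(EFin \o h) y|)%E in Ih.
have mah : measurable_fun setT (fun y => `|(EFin \o h) y|)%E.
  by apply: measurableT_comp => //; exact/measurable_EFinP.
have mag : measurable_fun setT (fun x => `|(EFin \o g) x|)%E.
  by apply: measurableT_comp => //; exact/measurable_EFinP.
have I0 : (0 <= I)%E by exact: integral_ge0.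
have Ifin : I \is a fin_num by rewrite ge0_fin_numE.
have inner x : (\int[P2]_y `|(g x * (B (x, y) * h y))%:E| <=
    (C * fine I)%:E * `|(g x)%:E|)%E.
  have -> : ((C * fine I)%:E * `|(g x)%:E| = (`|g x| * C)%:E * I)%E.
    by rewrite -{2}(fineK Ifin) -!EFinM; congr EFin; ring.
  rewrite -ge0_integralZl//; last by rewrite lee_fin mulr_ge0.
  apply: ge0_le_integral => //.
  - apply: measurableT_comp => //; apply/measurable_EFinP.
    apply: measurable_funM => //; apply: measurable_funM => //.
    exact: measurable_fun_pair2.
  - exact: measurable_funeM.
  - move=> y _; rewrite /= lee_fin !normrM mulrA -!mulrA.
    by rewrite ler_wpM2l// ler_wpM2r.
have mG : measurable_fun setT (fun x => (C * fine I)%:E * `|(EFin \o g) x|)%E.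
  exact: measurable_funeM.
apply: (@le_lt_trans _ _ (\int[P1]_x ((C * fine I)%:E * `|(EFin \o g) x|))%E).
  apply: ge0_le_integral => //.
  - by move=> x _; exact: integral_ge0.
  - apply: (measurable_fun_fubini_tonelli_F (fun z => `|(g z.1 * (B z * h z.2))%:E|%E)) => //.
    exact: measurableT_comp.
  - by move=> x _; exact: inner.
rewrite ge0_integralZl//; last by rewrite lee_fin mulr_ge0// fine_ge0.
by rewrite lte_mul_pinfty// lee_fin mulr_ge0// fine_ge0.
Qed.

Lemma measurable_integral_operator h : P2.-integrable setT (EFin \o h) ->
  measurable_fun setT (fun x => \int[P2]_y (B (x, y) * h y)).
Proof.
(* With g = 1 the partial integral in Fubini's theorem is the operator itself. *)
move=> hi; have := integ_bilinear (integ_cst P1 1) hi.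
move=> /measurable_fubini_F mF.
apply: (measurableT_comp (fine_measurable measurableT)).
apply: eq_measurable_fun mF => x _ /=.
by apply: eq_integral => y _; rewrite /= mul1r.
Qed.

Lemma le_norm_integral_operator h x : P2.-integrable setT (EFin \o h) ->
  `|\int[P2]_y (B (x, y) * h y)| <= C * \int[P2]_y `|h y|.
Proof.
move=> hi; apply: (le_trans (le_normr_Rintegral measurableT (integ_kernel _ hi))).
rewrite -RintegralZl//; last exact: integ_norm.
apply: le_Rintegral => //.
- exact/integ_norm/integ_kernel.
- exact/integZ/integ_norm.
- by move=> y _; rewrite normrM ler_wpM2r.
Qed.

Lemma integ_operatorM g h :
  P1.-integrable setT (EFin \o g) -> P2.-integrable setT (EFin \o h) ->
  P1.-integrable setT
    (EFin \o (fun x => g x * \int[P2]_y (B (x, y) * h y))).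
Proof.
move=> gi hi.
have := integM_bounded (measurable_integral_operator hi)
  (fun x => le_norm_integral_operator x hi) gi.
by apply: eq_integrable => // x _ /=; rewrite mulrC.
Qed.

End integral_operator.

Section operator_duality.
Context d1 d2 (T1 : measurableType d1) (T2 : measurableType d2) (R : realType).
Context (P1 : probability T1 R) (P2 : probability T2 R).
Variables (B : T1 * T2 -> R) (C : R).
Hypothesis mB : measurable_fun setT B.
Hypothesis BC : forall z, `|B z| <= C.

Lemma swap_measurable (D : T1 * T2 -> R) :
  measurable_fun setT D -> measurable_fun setT (fun z : T2 * T1 => D (z.2, z.1)).
Proof.
move=> mD; apply: (measurableT_comp mD); apply: measurable_fun_pair.
  exact: measurable_snd.
exact: measurable_fst.
Qed.

(** Fubini in the form of a transpose. The Gram identities, the vanishing mean of [conjugate] and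
    the composed kernel of two truncations are all instances. *)
Lemma integral_operator_duality g h :
  P1.-integrable setT (EFin \o g) -> P2.-integrable setT (EFin \o h) ->
  \int[P1]_x (g x * \int[P2]_y (B (x, y) * h y)) =
  \int[P2]_y (h y * \int[P1]_x (B (x, y) * g x)).
Proof.
move=> gi hi.
have := Fubini (integ_bilinear mB BC gi hi).
move=> /(congr1 fine) E.
rewrite /Rintegral; transitivity
  (fine (\int[P1]_x \int[P2]_y (g x * (B (x, y) * h y))%:E)%E).
  congr fine; apply: eq_integral => x _.
  rewrite -RintegralZl//; last exact: (integ_kernel mB BC).
  rewrite fineK//; apply: integrable_fin_num => //.
  exact/integZ/(integ_kernel mB BC).
rewrite [LHS]E; congr fine; apply: eq_integral => y _.
pose B' z := B (z.2, z.1).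
have iy := @integ_kernel _ _ _ _ _ P1 B' C (swap_measurable mB) (fun z => BC _) g y gi.
rewrite -RintegralZl//.
rewrite fineK; last first.
  by apply: integrable_fin_num => //; exact: integZ.
by apply: eq_integral => x _ /=; congr EFin; rewrite /B' /=; ring.
Qed.

End operator_duality.

(** * Gram kernels and Schur's test *)

Section gram_kernel.
Context d (T : measurableType d) (R : realType) (P : probability T R).
Variables (k : T * T -> R) (C : R).
Hypothesis mk : measurable_fun setT k.
Hypothesis kC : forall z, `|k z| <= C.

(** Kernel of K^T K, where K has kernel [k]. The order of the factors is the one that
    [integral_operator_duality] produces. *)
Definition gram (z : T * T) : R := \int[P]_x (k (x, z.2) * k (x, z.1)).

Let mk1 y : measurable_fun setT (fun x => k (x, y)).
Proof. exact: measurable_fun_pair1. Qed.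

Let mk2 x : measurable_fun setT (fun y => k (x, y)).
Proof. exact: measurable_fun_pair2. Qed.

Let ik1 y : P.-integrable setT (EFin \o (fun x => k (x, y))).
Proof. by apply: (@integ_bounded _ _ _ _ _ C). Qed.

Let kk_bounded x y y' : `|k (x, y') * k (x, y)| <= C * C.
Proof. by rewrite normrM ler_pM. Qed.

Lemma measurable_gram : measurable_fun setT gram.
Proof.
(* The Gram kernel is an integral operator from T to T * T applied to 1, so its measurability is
   that of such operators. *)
pose B (w : (T * T) * T) := k (w.2, w.1.2) * k (w.2, w.1.1).
have mB : measurable_fun setT B.
  apply: measurable_funM; apply: (measurableT_comp mk);
    apply: measurable_fun_pair; try exact: measurable_snd.
  - exact: (measurableT_comp measurable_snd measurable_fst).
  - exact: (measurableT_comp measurable_fst measurable_fst).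
have BC w : `|B w| <= C * C by exact: kk_bounded.
have := measurable_integral_operator (P \x P)%E mB BC (integ_cst P 1).
apply: eq_measurable_fun => z _; rewrite /gram.
by apply: eq_Rintegral => x _; rewrite /B mulr1.
Qed.

Lemma gram_bounded z : `|gram z| <= C * C.
Proof.
apply: le_norm_Rintegral => // .
apply: (@integ_bounded _ _ _ _ _ (C * C)) => //.
exact: measurable_funM.
Qed.

Lemma integ_gram s : P.-integrable setT (EFin \o (fun r => gram (s, r))).
Proof.
apply: (@integ_bounded _ _ _ _ _ (C * C)) => [|r]; last exact: gram_bounded.
exact: measurable_fun_pair2 measurable_gram.
Qed.

Lemma gramC s r : gram (s, r) = gram (r, s).
Proof. by apply: eq_Rintegral => x _; rewrite mulrC. Qed.

(** The row mass is K^T K 1. It vanishes when the rows of [k] have mean zero, and is at most 1 when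
    [k] takes values in [0, 1]. *)
Lemma Rintegral_gram s :
  \int[P]_r gram (s, r) = \int[P]_x (k (x, s) * \int[P]_r k (x, r)).
Proof.
have := integral_operator_duality mk kC (ik1 s) (integ_cst P 1).
under eq_Rintegral do under eq_Rintegral do rewrite mulr1.
by move=> ->; apply: eq_Rintegral => r _; rewrite mul1r.
Qed.

(** |K f|^2 = (f, K^T K f). Duality is used twice: first to move the outer K, then to write K^T (K
    f) through the Gram kernel. *)
Lemma Rintegral_operator_sqr f : P.-integrable setT (EFin \o f) ->
  \int[P]_x (\int[P]_y (k (x, y) * f y)) ^+ 2 =
  \int[P]_s (f s * \int[P]_r (gram (s, r) * f r)).
Proof.
move=> fi; set g := fun x => _.
pose h x := \int[P]_y (k (x, y) * f y).
have hi : P.-integrable setT (EFin \o h).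
  apply: (@integ_bounded _ _ _ _ _ (C * \int[P]_y `|f y|)).
    exact: measurable_integral_operator.
  by move=> x; exact: le_norm_integral_operator.
transitivity (\int[P]_x (h x * \int[P]_y (k (x, y) * f y))).
  by apply: eq_Rintegral => x _; rewrite /g expr2.
rewrite (integral_operator_duality mk kC hi fi).
apply: eq_Rintegral => s _; congr (_ * _).
rewrite /h (integral_operator_duality mk kC (ik1 s) fi).
by apply: eq_Rintegral => r _; rewrite mulrC.
Qed.

End gram_kernel.

(* Schur's test for the sum of the Gram kernels of [k] and [j]: being
   nonnegative, it acts on L2 with norm at most its total mass, to which [k]
   does not contribute. *)
Lemma integral_operator_contraction d (T : measurableType d) (R : realType)
    (P : probability T R) (k j : T * T -> R) (C : R) (f : T -> R) :
  measurable_fun setT k -> (forall z, `|k z| <= C) ->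
  measurable_fun setT j -> (forall z, 0 <= j z <= 1) ->
  (forall x, \int[P]_y k (x, y) = 0) ->
  (forall z, 0 <= gram P k z + gram P j z) ->
  square_integrable P f ->
  \int[P]_x (\int[P]_y (k (x, y) * f y)) ^+ 2 <= \int[P]_x f x ^+ 2.
Proof.
move=> mk kC mj j01 k0 Phi0 sf.
have fi := square_integrable_integ sf; have [_ f2i] := sf.
have jC z : `|j z| <= 1 by have /andP[? ?] := j01 z; rewrite ger0_norm.
pose Phi z := gram P k z + gram P j z.
have mPhi : measurable_fun setT Phi.
  by apply: measurable_funD; [exact: (measurable_gram P mk kC)|exact: (measurable_gram P mj jC)].
pose M := C * C + 1 * 1.
have PhiM z : `|Phi z| <= M.
  apply: (le_trans (ler_normD _ _)); rewrite lerD//.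
    exact: (gram_bounded P mk kC).
  exact: (gram_bounded P mj jC).
have iPhif g s : P.-integrable setT (EFin \o g) ->
    P.-integrable setT (EFin \o (fun r => Phi (s, r) * g r)).
  by move=> gi; exact: (integ_kernel mPhi PhiM).
have mass1 s : \int[P]_r Phi (s, r) <= 1.
  have igk := integ_gram P mk kC s; have igj := integ_gram P mj jC s.
  rewrite RintegralD//.
  rewrite (Rintegral_gram P mk kC) (Rintegral_gram P mj jC).
  under eq_Rintegral do rewrite k0 mulr0.
  rewrite probability_Rintegral_cst add0r.
  have mJ : measurable_fun setT (fun x => \int[P]_r j (x, r)).
    have := measurable_integral_operator P mj jC (integ_cst P 1).
    apply: eq_measurable_fun => x _.
    by apply: eq_Rintegral => r _; rewrite mulr1.
  have J1 x : `|\int[P]_r j (x, r)| <= 1.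
    apply: le_norm_Rintegral => // .
    apply: (@integ_bounded _ _ _ _ _ 1) => //.
    exact: measurable_fun_pair2.
  have jJ1 x : `|j (x, s) * \int[P]_r j (x, r)| <= 1.
    by rewrite normrM -[leRHS]mulr1 ler_pM.
  apply: (le_trans (ler_norm _)); apply: le_norm_Rintegral => //.
  apply: (@integ_bounded _ _ _ _ _ 1) => //.
  by apply: measurable_funM => //; exact: measurable_fun_pair1.
set Q := fun x => _.
have QE : \int[P]_x Q x + \int[P]_x (\int[P]_y (j (x, y) * f y)) ^+ 2 =
    \int[P]_s (f s * \int[P]_r (Phi (s, r) * f r)).
  rewrite /Q (Rintegral_operator_sqr mk kC fi) (Rintegral_operator_sqr mj jC fi).
  have mgk := measurable_gram P mk kC; have gkC := gram_bounded P mk kC.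
  have mgj := measurable_gram P mj jC; have gjC := gram_bounded P mj jC.
  rewrite -RintegralD//; last 2 first.
  - exact: (integ_operatorM mgk gkC).
  - exact: (integ_operatorM mgj gjC).
  apply: eq_Rintegral => s _; rewrite -mulrDr -RintegralD//.
  - by congr (_ * _); apply: eq_Rintegral => r _; rewrite -mulrDl.
  - exact: (integ_kernel mgk gkC).
  - exact: (integ_kernel mgj gjC).
(* Adding the square norm of the operator of [j] only increases the left side and completes the
   kernel to the nonnegative [Phi]. *)
apply: (@le_trans _ _ (\int[P]_x Q x + \int[P]_x (\int[P]_y (j (x, y) * f y)) ^+ 2)).
  by rewrite lerDl; apply: Rintegral_ge0 => x _; exact: sqr_ge0.
rewrite {}QE.
pose I s := \int[P]_r (Phi (s, r) * f r ^+ 2).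
(* This is f s f r <= (f s ^ 2 + f r ^ 2) / 2 weighted by [Phi]. The factors 1 keep both halves in
   the shape that duality accepts. *)
have amgm s : f s * \int[P]_r (Phi (s, r) * f r) <=
    2^-1 * (f s ^+ 2 * \int[P]_r (Phi (s, r) * 1) + 1 * I s).
  have i1 := integZ (f s ^+ 2) (iPhif (fun=> 1) s (integ_cst P 1)).
  have i2 := iPhif (fun r => f r ^+ 2) s f2i.
  rewrite mul1r -(RintegralZl (f s ^+ 2))//; last exact: (iPhif (fun=> 1) s (integ_cst P 1)).
  rewrite -RintegralD// -(RintegralZl (f s))//; last exact: iPhif.
  rewrite -(RintegralZl 2^-1)//; last exact: (integD i1 i2).
  apply: le_Rintegral => //.
  - exact/integZ/iPhif.
  - exact: integZ (integD i1 i2).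
  move=> r _; rewrite -subr_ge0.
  have -> : 2^-1 * (f s ^+ 2 * (Phi (s, r) * 1) + Phi (s, r) * f r ^+ 2) -
    f s * (Phi (s, r) * f r) = 2^-1 * (Phi (s, r) * (f s - f r) ^+ 2) by field.
  by apply: mulr_ge0 => //; apply: mulr_ge0; [exact: Phi0|exact: sqr_ge0].
have i1 := integ_operatorM mPhi PhiM f2i (integ_cst P 1).
have i2 := integ_operatorM mPhi PhiM (integ_cst P 1) f2i.
apply: (@le_trans _ _ (\int[P]_s (2^-1 * (f s ^+ 2 * \int[P]_r (Phi (s, r) * 1) + 1 * I s)))).
  apply: le_Rintegral => //; first exact: (integ_operatorM mPhi PhiM).
  exact: integZ (integD i1 i2).
(* By symmetry both halves of the AM-GM bound have the same integral. *)
have PhiC s r : Phi (s, r) = Phi (r, s) by rewrite /Phi !(gramC _ _ s).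
rewrite RintegralZl//; last exact: integD i1 i2.
rewrite RintegralD//.
rewrite (integral_operator_duality mPhi PhiM (integ_cst P 1) f2i).
have -> : \int[P]_y (f y ^+ 2 * \int[P]_x (Phi (x, y) * 1)) =
    \int[P]_s (f s ^+ 2 * \int[P]_r (Phi (s, r) * 1)).
  by apply: eq_Rintegral => s _; congr (_ * _); apply: eq_Rintegral => r _; rewrite PhiC.
rewrite -mulr2n -[X in 2^-1 * X]mulr_natl mulrA mulVf// mul1r.
apply: le_Rintegral => // s _.
rewrite -[leRHS]mulr1 ler_wpM2l ?sqr_ge0//.
under eq_Rintegral do rewrite mulr1.
exact: mass1.
Qed.

(** * The law of the angle *)

Section angle_law.
Context {R : realType}.
Local Notation leb := (@lebesgue_measure R).
Local Notation I := (`]- pi, pi]%classic : set R).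

Definition angle_law : set (measurableTypeR R) -> \bar R :=
  mscale (NngNum (@inv_2pi_ge0 R)) (mrestr leb (measurable_itv `]- pi, pi : R])).

HB.instance Definition _ := Measure.on angle_law.

(** The equality holds on every set, so level sets of [hilbert] can be moved to the line before
    anything is known about their measurability. *)
Lemma haarE (A : set (circle R)) : haar A = angle_law (@expi R @^-1` A).
Proof. by []. Qed.

Lemma angle_lawE (A : set R) :
  angle_law A = ((2 * pi)^-1%:E * leb (A `&` I))%E.
Proof. by []. Qed.

Lemma angle_law_itv (a b : R) : - pi <= a -> a <= b -> b <= pi ->
  angle_law `]a, b[%classic = ((b - a) / (2 * pi))%:E.
Proof.
move=> pa ab bp; rewrite angle_lawE setIidl; last first.
  move=> x /=; rewrite !in_itv/= => /andP[ax xb].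
  by rewrite (le_lt_trans pa ax)/= (le_trans (ltW xb)).
rewrite lebesgue_measure_itv/= lte_fin; case: ltgtP ab => // [ab|->] _.
  by rewrite -EFinD -EFinM mulrC.
by rewrite subrr mul0r mule0.
Qed.

Lemma angle_law_set1 (a : R) : angle_law [set a] = 0%E.
Proof.
apply/eqP; rewrite eq_le measure_ge0 andbT angle_lawE.
rewrite [X in (_ * X)%E](_ : _ = 0%E) ?mule0//.
apply/eqP; rewrite eq_le measure_ge0 andbT -(lebesgue_measure_set1 a).
by apply: measureIl => //; exact: measurable_itv.
Qed.

Let angle_lawT : angle_law [set: _] = 1%:E.
Proof.
rewrite angle_lawE setTI lebesgue_measure_itv/= lte_fin gtrN ?pi_gt0//.
rewrite -EFinD -EFinM opprK -mulr2n -(mulr_natl pi) mulVf//.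
by rewrite mulf_neq0// gt_eqF// pi_gt0.
Qed.

HB.instance Definition _ :=
  @Measure_isProbability.Build _ _ R angle_law angle_lawT.

Lemma ge0_integral_angle_law (f : R -> \bar R) :
  measurable_fun setT f -> (forall x, 0 <= f x)%E ->
  (\int[angle_law]_x f x = (2 * pi)^-1%:E * \int[leb]_(x in I) f x)%E.
Proof.
move=> mf f0; pose m : measure (measurableTypeR R) R := mrestr leb (measurable_itv `]- pi, pi : R]).
transitivity ((2 * pi)^-1%:E * \int[m]_x f x)%E.
  exact: (ge0_integral_mscale m measurableT (NngNum (@inv_2pi_ge0 R))).
congr (_ * _)%E.
have mI : measurable I by exact: measurable_itv.
have mCI : measurable (~` I) by exact: measurableC.
have mfU : measurable_fun (I `|` ~` I) f by exact: measurable_funTS.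
have disjI : [disjoint I & ~` I] by apply/disj_setPS; rewrite setICr.
rewrite -(setUv I) (ge0_integral_setU m mI mCI mfU _ disjI)//.
rewrite [X in (_ + X)%E](_ : _ = 0%E); last first.
  apply: null_set_integral => //.
  - exact: measurable_funTS.
  - by rewrite /= /mrestr setICl measure0.
rewrite adde0; apply: eq_measure_integral => A mA AI.
by rewrite /= /mrestr setIidl.
Qed.

Lemma Rintegral_angle_law (f : R -> R) : measurable_fun setT f ->
  \int[angle_law]_x f x = (2 * pi)^-1 * \int[leb]_(x in `[- pi, pi]) f x.
Proof.
move=> mf; have mef : measurable_fun setT (EFin \o f) by exact/measurable_EFinP.
have k0 : 0 < (2 * pi : R)^-1 by rewrite invr_gt0 mulr_gt0 ?pi_gt0.
(* Distributivity also covers the infinite values, including +oo - +oo; [fine] then returns 0 on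
   both sides. *)
have distr (k : R) (a b : \bar R) : 0 < k ->
    (k%:E * a - k%:E * b = k%:E * (a - b))%E.
  move=> {}k0; case: a => [a||]; case: b => [b||] //=;
    rewrite ?(gt0_muley, gt0_muleNy, lte_fin)//.
  - by rewrite -!EFinB -!EFinM mulrBr.
rewrite /Rintegral -integral_itv_obnd_cbnd; last exact: measurable_funTS.
rewrite integralE ge0_integral_angle_law//; last exact: measurable_funepos.
rewrite ge0_integral_angle_law//; last exact: measurable_funeneg.
rewrite distr// -integralE.
by case: integral => [r||] //=; rewrite ?gt0_muley ?gt0_muleNy ?lte_fin//= mulr0.
Qed.

(** The image measure gives half-open intervals their length, which determines Lebesgue measure. *)
Lemma lebesgue_measureD (a : R) (A : set R) : measurable A ->
  pushforward leb ((fun x => x + a) : measurableTypeR R -> measurableTypeR R) A = leb A.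
Proof.
have ms : measurable_fun setT ((fun x : R => x + a) : measurableTypeR R -> measurableTypeR R).
  exact: measurable_funD.
move=> mA; apply/esym; apply: (@lebesgue_measure_unique _
   (measure_function_pushforward__canonical__measure_function_Measure leb ms)) => //.
move=> _ [[b c]] _ <-; rewrite /= /pushforward.
rewrite [X in _ = leb X](_ : _ = `]b - a, c - a]%classic); last first.
  by apply/seteqP; split => x /=; rewrite !in_itv/= ltrBlDr lerBrDr.
by rewrite !lebesgue_measure_itv/= !lte_fin ltrD2r -!EFinD opprB addrA subrK.
Qed.

Lemma ge0_integral_translation (a b c : R) (f : R -> \bar R) :
  measurable_fun setT f -> (forall x, 0 <= f x)%E ->
  (\int[leb]_(x in `]b, c]) f (x + a)%R =
   \int[leb]_(x in `](b + a)%R, (c + a)%R]) f x)%E.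
Proof.
move=> mf f0.
have ms : measurable_fun setT ((fun x : R => x + a) : measurableTypeR R -> measurableTypeR R).
  exact: measurable_funD.
have -> : `]b, c]%classic = (fun x => x + a) @^-1` `](b + a), (c + a)].
  by apply/seteqP; split => x /=; rewrite !in_itv/= ltrD2r lerD2r.
have mD : measurable (`](b + a), (c + a)] : set (measurableTypeR R)).
  exact: measurable_itv.
apply: (etrans (esym (ge0_integral_pushforward ms leb mD (measurable_funTS mf)
  (fun x _ => f0 x)))).
by apply: eq_measure_integral => A mA _; exact/lebesgue_measureD.
Qed.

(** The windows ]-pi, pi] and ]-pi + a, pi + a] share ]-pi + a, pi]; their remaining pieces are one
    period apart. *)
Let ge0_integral_period (a : R) (f : R -> \bar R) :
  measurable_fun setT f -> (forall x, 0 <= f x)%E ->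
  (forall x, f (x + pi *+ 2) = f x) -> 0 <= a <= pi *+ 2 ->
  (\int[leb]_(x in I) f (x + a)%R = \int[leb]_(x in I) f x)%E.
Proof.
move=> mf f0 pf /andP[a0 a2]; rewrite ge0_integral_translation//.
have mfT (A : set R) : measurable_fun A f by exact: measurable_funTS.
have splitI (b c d : R) : b <= c -> c <= d ->
    (\int[leb]_(x in `]b, d]) f x =
     \int[leb]_(x in `]b, c]) f x + \int[leb]_(x in `]c, d]) f x)%E.
  move=> bc cd.
  have disj : [disjoint `]b, c]%classic & `]c, d]%classic].
    apply/disj_setPS => x /=; rewrite !in_itv/= => -[/andP[_ xc] /andP[cx _]].
    by move: (le_lt_trans xc cx); rewrite ltxx.
  rewrite -(ge0_integral_setU leb _ _ (mfT _) _ disj)//.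
  by rewrite -itv_bndbnd_setU// bnd_simp.
have a2' : - pi + a <= pi by rewrite mulr2n in a2; lra.
rewrite (splitI _ pi)//; last by lra.
rewrite (splitI (- pi) (- pi + a))//; last by lra.
rewrite addeC; congr (_ + _)%E.
have -> : (pi + a = (- pi + a) + pi *+ 2 :> R)%R by rewrite mulr2n; ring.
have {1}-> : (pi = - pi + pi *+ 2 :> R)%R by rewrite mulr2n; ring.
by rewrite -ge0_integral_translation//; apply: eq_integral => x _; rewrite pf.
Qed.

(** A shift in [0, 2 pi] cuts a single period. A larger one is a multiple of such a shift, and a
    negative one is undone by the opposite shift. *)
Lemma Rintegral_angle_lawD (a : R) (f : R -> R) :
  measurable_fun setT f -> periodic f (pi *+ 2) ->
  \int[angle_law]_x f (x + a) = \int[angle_law]_x f x.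
Proof.
have mshift (b : R) (g : R -> R) : measurable_fun setT g ->
    measurable_fun setT (fun x : R => g (x + b)).
  by move=> mg; apply: measurableT_comp => //; exact: measurable_funD.
have pshift (b : R) (g : R -> R) : periodic g (pi *+ 2) ->
    periodic (fun x => g (x + b)) (pi *+ 2).
  by move=> pg x; rewrite addrAC pg.
have small (b : R) (g : R -> R) : 0 <= b <= pi *+ 2 ->
    measurable_fun setT g -> periodic g (pi *+ 2) ->
    \int[angle_law]_x g (x + b) = \int[angle_law]_x g x.
  move=> b02 mg pg.
  have meg : measurable_fun setT (EFin \o g) by exact/measurable_EFinP.
  have megb : measurable_fun setT (EFin \o (fun x : R => g (x + b))).
    by apply/measurable_EFinP; exact: mshift.
  rewrite /Rintegral; congr fine; rewrite integralE [RHS]integralE.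
  congr (_ - _)%E.
  - rewrite !ge0_integral_angle_law//; try exact: measurable_funepos.
    have per x : ((EFin \o g)^\+ (x + pi *+ 2)%R = (EFin \o g)^\+ x)%E.
      by rewrite !funeposE /= pg.
    have E := ge0_integral_period (measurable_funepos meg) (funepos_ge0 _) per b02.
    by rewrite -E; congr (_ * _)%E; apply: eq_integral => x _; rewrite !funeposE.
  - rewrite !ge0_integral_angle_law//; try exact: measurable_funeneg.
    have per x : ((EFin \o g)^\- (x + pi *+ 2)%R = (EFin \o g)^\- x)%E.
      by rewrite !funenegE /= pg.
    have E := ge0_integral_period (measurable_funeneg meg) (funeneg_ge0 _) per b02.
    by rewrite -E; congr (_ * _)%E; apply: eq_integral => x _; rewrite !funenegE.
have multiple (n : nat) (b : R) (g : R -> R) : 0 <= b <= pi *+ 2 ->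
    measurable_fun setT g -> periodic g (pi *+ 2) ->
    \int[angle_law]_x g (x + b *+ n) = \int[angle_law]_x g x.
  move=> b02; elim: n g => [|n IHn] g mg pg.
    by apply: eq_Rintegral => x _; rewrite mulr0n addr0.
  rewrite -(IHn g)//.
  rewrite -(small b _ b02 (mshift (b *+ n) _ mg) (pshift (b *+ n) _ pg)).
  by apply: eq_Rintegral => x _; rewrite mulrS addrA.
have nonneg (b : R) (g : R -> R) : 0 <= b ->
    measurable_fun setT g -> periodic g (pi *+ 2) ->
    \int[angle_law]_x g (x + b) = \int[angle_law]_x g x.
  (* With n > b the n equal shifts b / n are below 1, hence within one period. *)
  move=> b0 mg pg; have := archi_boundP b0; set n := Num.bound b => bn.
  have n0 : (0 < n%:R :> R) by exact: le_lt_trans bn.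
  rewrite -(multiple n (b / n%:R) g)//.
    apply: eq_Rintegral => x _; congr (g (_ + _)).
    by rewrite -(mulr_natr (b / n%:R)) divfK// gt_eqF.
  apply/andP; split; first by apply: divr_ge0 => //; exact: ltW.
  rewrite ler_pdivrMr//; apply: (le_trans (ltW bn)); apply: ler_peMl; first exact: ltW.
  by have := pi_ge2 R; rewrite mulr2n; lra.
move=> mf pf; have [a0|a0] := leP 0 a; first exact: nonneg.
have Na0 : 0 <= - a by rewrite oppr_ge0 ltW.
rewrite -(nonneg _ _ Na0 (mshift a _ mf) (pshift a _ pf)).
by apply: eq_Rintegral => x _; rewrite subrK.
Qed.

Lemma Rintegral_angle_lawN (f : R -> R) : measurable_fun setT f ->
  \int[angle_law]_x f (- x) = \int[angle_law]_x f x.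
Proof.
have ge0case (g : R -> \bar R) : measurable_fun setT g -> (forall x, 0 <= g x)%E ->
    (\int[leb]_(x in I) g (- x)%R = \int[leb]_(x in I) g x)%E.
  move=> mg g0.
  have mN : measurable_fun setT (-%R : measurableTypeR R -> measurableTypeR R)
    by exact: oppr_measurable.
  have mgT (A : set R) : measurable_fun A g by exact: measurable_funTS.
  have mgN (A : set R) : measurable_fun A (fun x : R => g (- x)%R).
    by apply: measurable_funTS; exact: measurableT_comp.
  (* Only the closed interval is symmetric; the added endpoint is null. *)
  rewrite (integral_itv_obnd_cbnd (mgN _)) (integral_itv_obnd_cbnd (mgT _)).
  have {1}-> : `[- pi, pi]%classic = -%R @^-1` `[- pi, pi] :> set R.
    by apply/seteqP; split => x /=; rewrite !in_itv/= => /andP[? ?]; apply/andP; split; lra.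
  have mD : measurable (`[- pi, pi] : set (measurableTypeR R)).
    exact: measurable_itv.
  apply: (etrans (esym (ge0_integral_pushforward mN leb mD (mgT _)
    (fun x _ => g0 x)))).
  by apply: eq_measure_integral => A mA _; exact/lebesgue_measureN.
move=> mf.
have mef : measurable_fun setT (EFin \o f) by exact/measurable_EFinP.
have mefN : measurable_fun setT (EFin \o (fun x : R => f (- x))).
  by apply/measurable_EFinP; exact: measurableT_comp.
rewrite /Rintegral; congr fine; rewrite integralE [RHS]integralE.
congr (_ - _)%E.
- rewrite !ge0_integral_angle_law//; try exact: measurable_funepos.
  rewrite -(ge0case _ (measurable_funepos mef) (funepos_ge0 _)).
  by congr (_ * _)%E; apply: eq_integral => x _; rewrite !funeposE.
- rewrite !ge0_integral_angle_law//; try exact: measurable_funeneg.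
  rewrite -(ge0case _ (measurable_funeneg mef) (funeneg_ge0 _)).
  by congr (_ * _)%E; apply: eq_integral => x _; rewrite !funenegE.
Qed.

Lemma Rintegral_angle_law_reflect (a : R) (f : R -> R) :
  measurable_fun setT f -> periodic f (pi *+ 2) ->
  \int[angle_law]_x f (a - x) = \int[angle_law]_x f x.
Proof.
move=> mf pf; rewrite -(Rintegral_angle_lawD a mf pf).
rewrite -[RHS]Rintegral_angle_lawN.
  by apply: eq_Rintegral => x _; rewrite addrC.
by apply: measurableT_comp => //; exact: measurable_funD.
Qed.

End angle_law.

(** * The truncated conjugation operator *)

Section truncated_kernel.
Context {R : realType}.
Implicit Types (e x t s u c : R).

Lemma one_sub_cos x : 1 - cos x = 2 * sin (x / 2) ^+ 2.
Proof.
have {1}-> : x = (x / 2) *+ 2 by rewrite -(mulr_natr (x / 2)) divfK.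
by have := cos2Dsin2 (x / 2); rewrite cos_mulr2n mulr2n; lra.
Qed.

(** The right side has period 2 pi and a nonnegative denominator, so parity, periodicity and sign
    can be read off. At multiples of 2 pi both sides are 0, the value of a division by zero. *)
Lemma cot_halfE x : cot (x / 2) = sin x / (1 - cos x).
Proof.
rewrite one_sub_cos /cot; have {3}-> : x = (x / 2) *+ 2.
  by rewrite -(mulr_natr (x / 2)) divfK.
rewrite sin_mulr2n; have [->|s0] := eqVneq (sin (x / 2)) 0.
  by rewrite mulr0 mul0rn mul0r invr0 mulr0.
by rewrite mulr2n; move: (sin _) (cos _) s0 => y c y0; field.
Qed.

(* [cos x < 1 - e^2/2] says that the chord from 1 to e^{ix} is longer than e. *)
Definition far e x : R := if cos x < 1 - e ^+ 2 / 2 then 1 else 0.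
Definition cot_kernel e x : R := far e x * cot (x / 2).

Lemma far01 e x : 0 <= far e x <= 1.
Proof. by rewrite /far; case: ifP; rewrite ?lexx ler01. Qed.

Lemma farN e x : far e (- x) = far e x.
Proof. by rewrite /far cosN. Qed.

Lemma periodic_far e : periodic (far e) (pi *+ 2).
Proof. by move=> x; rewrite /far cosD2pi. Qed.

Lemma cot_kernelN e x : cot_kernel e (- x) = - cot_kernel e x.
Proof. by rewrite /cot_kernel farN !cot_halfE sinN cosN mulNr mulrN. Qed.

Lemma periodic_cot_kernel e : periodic (cot_kernel e) (pi *+ 2).
Proof. by move=> x; rewrite /cot_kernel periodic_far !cot_halfE sinD2pi cosD2pi. Qed.

Lemma far_sin e x : 0 <= e -> far e x != 0 -> e / 2 < `|sin (x / 2)|.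
Proof.
rewrite /far => e0; case: ifPn; rewrite ?eqxx// => cx _.
have := one_sub_cos x => E.
rewrite -(@ltr_pXn2r _ 2)// ?nnegrE ?normr_ge0 ?divr_ge0//.
by rewrite real_normK ?num_real// expr_div_n; lra.
Qed.

Lemma norm_cot_le x c : 0 < c -> c <= `|sin (x / 2)| -> `|cot (x / 2)| <= c^-1.
Proof.
move=> c0 cs; rewrite /cot normrM normfV -[leRHS]mul1r ler_pM//.
  by rewrite ler_norml cos_geN1 cos_le1.
by rewrite lef_pV2// posrE (lt_le_trans c0).
Qed.

Lemma cot_kernel_bounded e x : 0 < e -> `|cot_kernel e x| <= 2 / e.
Proof.
move=> e0; rewrite /cot_kernel; have [->|fx] := eqVneq (far e x) 0.
  by rewrite mul0r normr0 divr_ge0// ltW.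
have := far_sin (ltW e0) fx; move=> /ltW/norm_cot_le.
rewrite divr_gt0// invf_div => /(_ isT); apply: le_trans.
rewrite normrM -[leRHS]mul1r ler_wpM2r//.
by have /andP[f0 f1] := far01 e x; rewrite ger0_norm.
Qed.

Lemma measurable_far e : measurable_fun setT (far e).
Proof.
apply: measurable_fun_ifT => //; apply: measurable_fun_ltr => //.
by apply: continuous_measurable_fun; exact: continuous_cos.
Qed.

Lemma measurable_cot_kernel e : measurable_fun setT (cot_kernel e).
Proof.
apply: measurable_funM; first exact: measurable_far.
have mc : measurable_fun setT (@cos R).
  by apply: continuous_measurable_fun; exact: continuous_cos.
have ms : measurable_fun setT (@sin R).
  by apply: continuous_measurable_fun; exact: continuous_sin.
(* On the nonnegative 1 - cos x, the real power of exponent -1 is the inverse, also at 0. *)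
apply: (eq_measurable_fun (fun x : R => sin x * (1 - cos x) `^ (-1))).
  move=> x _; rewrite cot_halfE powR_inv1// subr_ge0; exact: cos_le1.
apply: measurable_funM => //; apply: (measurableT_comp (measurable_powR _)).
exact: measurable_funB.
Qed.

Lemma integ_cot_kernel e t : 0 < e ->
  angle_law.-integrable setT (EFin \o (fun s => cot_kernel e (t - s))).
Proof.
move=> e0; apply: (@integ_bounded _ _ _ _ _ (2 / e)) => [|x].
  apply: (measurableT_comp (measurable_cot_kernel e)).
  exact: measurable_funB.
exact: cot_kernel_bounded.
Qed.

(** After a reflection around t, oddness equates the integral with its opposite. *)
Lemma Rintegral_cot_kernel e t : 0 < e ->
  \int[angle_law]_s cot_kernel e (t - s) = 0.
Proof.
move=> e0; have mk := measurable_cot_kernel e.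
rewrite (Rintegral_angle_law_reflect t mk (periodic_cot_kernel e)).
have := Rintegral_angle_lawN mk.
have ik : angle_law.-integrable setT (EFin \o cot_kernel e).
  by apply: (@integ_bounded _ _ _ _ _ (2 / e)) => // x; exact: cot_kernel_bounded.
under eq_Rintegral do rewrite cot_kernelN -mulN1r.
by rewrite RintegralZl// mulN1r; lra.
Qed.

Lemma cotM1 (a b : R) : sin a != 0 -> sin b != 0 -> sin (a - b) != 0 ->
  cot a * cot b + 1 = cot (a - b) * (cot b - cot a).
Proof.
move=> sa sb; rewrite /cot sinB cosB => sab; field.
by rewrite sa sb sab.
Qed.

Lemma far_sin_neq0 e x : 0 <= e -> far e x != 0 -> sin (x / 2) != 0.
Proof.
move=> e0 /(far_sin e0) es; rewrite -normr_gt0; apply: le_lt_trans es.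
by rewrite divr_ge0.
Qed.

(* The sign comes from [cos (u + t) - cos (u - t) = - 2 sin u sin t]. *)
Lemma cot_kernel_monotone e t u :
  0 <= cot (t / 2) * (cot_kernel e u * (far e (u + t) - far e (u - t))).
Proof.
suff H : 0 <= cot (t / 2) * cot (u / 2) * (far e (u + t) - far e (u - t)).
  rewrite /cot_kernel.
  have -> : cot (t / 2) * (far e u * cot (u / 2) * (far e (u + t) - far e (u - t))) =
    far e u * (cot (t / 2) * cot (u / 2) * (far e (u + t) - far e (u - t))) by ring.
  by rewrite mulr_ge0//; have /andP[] := far01 e u.
rewrite !cot_halfE.
have t0 : 0 <= (1 - cos t)^-1 by rewrite invr_ge0 subr_ge0 cos_le1.
have u0 : 0 <= (1 - cos u)^-1 by rewrite invr_ge0 subr_ge0 cos_le1.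
have -> : sin t / (1 - cos t) * (sin u / (1 - cos u)) * (far e (u + t) - far e (u - t))
  = (1 - cos t)^-1 * (1 - cos u)^-1 * (sin t * sin u * (far e (u + t) - far e (u - t))) by ring.
apply: (mulr_ge0 (mulr_ge0 t0 u0)); rewrite /far cosB cosD.
case: ifPn => [c1|]; case: ifPn => [c2|]; rewrite -?leNgt => // ; try move=> c2;
  rewrite ?subrr ?mulr0//.
- by rewrite subr0 mulr1; lra.
- by rewrite sub0r mulrN1; lra.
Qed.

Definition cot_conv e (z : measurableTypeR R * measurableTypeR R) : R := cot_kernel e (z.1 - z.2).
Definition far_conv e (z : measurableTypeR R * measurableTypeR R) : R := far e (z.1 - z.2).

Lemma measurable_subr : measurable_fun setT (fun z : R * R => z.1 - z.2).
Proof. by apply: measurable_funB; [exact: measurable_fst|exact: measurable_snd]. Qed.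

Lemma measurable_cot_conv e : measurable_fun setT (cot_conv e).
Proof. exact: (measurableT_comp (measurable_cot_kernel e) measurable_subr). Qed.

Lemma measurable_far_conv e : measurable_fun setT (far_conv e).
Proof. exact: (measurableT_comp (measurable_far e) measurable_subr). Qed.

Lemma integ_kernelD (f : R -> R) (C : R) (a : R) :
  measurable_fun setT f -> (forall x, `|f x| <= C) ->
  angle_law.-integrable setT (EFin \o (fun x => f (x + a))).
Proof.
move=> mf fC; apply: (@integ_bounded _ _ _ _ _ C) => [|x]; last exact: fC.
by apply: (measurableT_comp mf); exact: measurable_funD.
Qed.

(* [cotM1] turns the integrand into a multiple of [far * cot_kernel] terms that
   differ by a translation, so that [cot_kernel_monotone] applies. *)
Lemma gram_conv_ge0 e z : 0 < e ->
  0 <= gram angle_law (cot_conv e) z + gram angle_law (far_conv e) z.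
Proof.
move=> e0; case: z => s r; rewrite /gram /cot_conv /far_conv /=.
have mk := measurable_cot_kernel e; have mf := measurable_far e.
have kb := @cot_kernel_bounded e ^~ e0.
have fb x : `|far e x| <= 1.
  by have /andP[f0 f1] := far01 e x; rewrite ger0_norm.
have ikk (f g : R -> R) (C D a b : R) : measurable_fun setT f -> measurable_fun setT g ->
    (forall x, `|f x| <= C) -> (forall x, `|g x| <= D) ->
    angle_law.-integrable setT (EFin \o (fun x => f (x + a) * g (x + b))).
  move=> mf' mg fC gD; have gi := integ_kernelD b mg gD.
  apply: (@integM_bounded _ _ _ angle_law _ (fun x => f (x + a)) C _ (fun x => fC (x + a)) gi).
  by apply: (measurableT_comp mf'); exact: measurable_funD.
rewrite -RintegralD//; [|exact: (ikk _ _ _ _ _ _ mk mk kb kb)|exact: (ikk _ _ _ _ _ _ mf mf fb fb)].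
set t := s - r.
(* Here s and r agree modulo 2 pi and the cotangent identity fails, but the integrand is a sum of
   two squares. *)
have [st|st] := eqVneq (sin (t / 2)) 0.
  apply: Rintegral_ge0 => x _.
  have ct : cos t = 1 by have := one_sub_cos t; rewrite st expr0n/= mulr0; lra.
  have sin0 : sin t = 0.
    have := cos2Dsin2 t; rewrite ct expr1n => /eqP; rewrite -subr_eq0 addrC addKr.
    by rewrite sqrf_eq0 => /eqP.
  have -> : x - r = (x - s) + t by rewrite /t; ring.
  move: (x - s) (t) ct sin0 => y v ct sin0.
  rewrite /cot_kernel /far !cot_halfE !cosD !sinD ct sin0 !mulr0 !mulr1 !subr0 !addr0.
  by rewrite -!expr2 addr_ge0// sqr_ge0.
have ikf a b := ikk _ _ _ _ a b mk mf kb fb.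
rewrite (_ : \int[angle_law]_x _ = cot (t / 2) *
    (\int[angle_law]_x (cot_kernel e (x - s) * far e (x - r)) -
     \int[angle_law]_x (cot_kernel e (x - r) * far e (x - s)))); last first.
  rewrite -RintegralB//.
  rewrite -RintegralZl//; last by apply: integB; exact: ikf.
  apply: eq_Rintegral => x _; rewrite /cot_kernel.
  have [->|fr] := eqVneq (far e (x - r)) 0; first by rewrite !(mulr0, mul0r, addr0, subr0).
  have [->|fs] := eqVneq (far e (x - s)) 0; first by rewrite !(mulr0, mul0r, addr0, subr0).
  have := cotM1 (far_sin_neq0 (ltW e0) fr) (far_sin_neq0 (ltW e0) fs).
  have -> : (x - r) / 2 - (x - s) / 2 = t / 2 by rewrite /t; field.
  move=> /(_ st) E; transitivity (far e (x - r) * far e (x - s) *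
    (cot ((x - r) / 2) * cot ((x - s) / 2) + 1)); first by ring.
  by rewrite E; ring.
(* Centring both integrals at the argument of [cot_kernel] leaves the truncations at x + t and x -
   t. *)
have shift (c a b : R) : \int[angle_law]_x (cot_kernel e (x - a) * far e (x - b)) =
    \int[angle_law]_x (cot_kernel e x * far e (x + (a - b))).
  rewrite -[RHS](Rintegral_angle_lawD (- a)).
  - by apply: eq_Rintegral => x _; congr (_ * far e _); ring.
  - apply: measurable_funM => //; apply: (measurableT_comp mf); exact: measurable_funD.
  - by move=> x; rewrite periodic_cot_kernel addrAC periodic_far.
rewrite !shift// -RintegralB//; last 2 first.
- by have := ikf 0 (s - r); apply: eq_integrable => // x _ /=; rewrite addr0.
- by have := ikf 0 (r - s); apply: eq_integrable => // x _ /=; rewrite addr0.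
rewrite -RintegralZl//; last first.
  apply: integB.
  - by have := ikf 0 (s - r); apply: eq_integrable => // x _ /=; rewrite addr0.
  - by have := ikf 0 (r - s); apply: eq_integrable => // x _ /=; rewrite addr0.
apply: Rintegral_ge0 => x _; rewrite -mulrBr.
have -> : x + (r - s) = x - t by rewrite /t; ring.
exact: cot_kernel_monotone.
Qed.

(** The operator H_e in the angle variable; [truncated_hilbertE] identifies it with
    [truncated_hilbert]. *)
Definition conjugate e (F : R -> R) t : R :=
  \int[angle_law]_s (cot_kernel e (t - s) * F s).

Section conjugate_operator.
Variables (e : R) (F : R -> R).
Hypothesis e0 : 0 < e.

Let kb z : `|cot_conv e z| <= 2 / e := cot_kernel_bounded _ e0.

Lemma measurable_conjugate : angle_law.-integrable setT (EFin \o F) ->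
  measurable_fun setT (conjugate e F).
Proof.
move=> Fi.
exact: (measurable_integral_operator angle_law (measurable_cot_conv e) kb).
Qed.

Lemma conjugate_bounded t : angle_law.-integrable setT (EFin \o F) ->
  `|conjugate e F t| <= 2 / e * \int[angle_law]_s `|F s|.
Proof. exact: (le_norm_integral_operator (measurable_cot_conv e) kb). Qed.

(** By duality the mean is the integral of [F] against the column means of the kernel, which vanish
    by oddness and translation invariance. *)
Lemma conjugate_mean0 : angle_law.-integrable setT (EFin \o F) ->
  \int[angle_law]_t conjugate e F t = 0.
Proof.
move=> Fi; have := integral_operator_duality (measurable_cot_conv e) kb
  (integ_cst angle_law 1) Fi.
under eq_Rintegral do rewrite mul1r.
rewrite /conjugate => ->.
under eq_Rintegral => s _.
  rewrite (_ : \int[angle_law]_x _ = 0); last first.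
    have := Rintegral_angle_lawD (- s) (measurable_cot_kernel e) (@periodic_cot_kernel e).
    have := Rintegral_cot_kernel 0 e0.
    under eq_Rintegral do rewrite sub0r.
    rewrite (Rintegral_angle_lawN (measurable_cot_kernel e)) => -> <-.
    by apply: eq_Rintegral => x _; rewrite mulr1.
  rewrite mulr0; over.
exact: probability_Rintegral_cst.
Qed.

Lemma conjugate_contraction : square_integrable angle_law F ->
  \int[angle_law]_t conjugate e F t ^+ 2 <= \int[angle_law]_t F t ^+ 2.
Proof.
apply: (integral_operator_contraction (measurable_cot_conv e) kb
  (measurable_far_conv e)).
- by move=> z; exact: far01.
- by move=> t; exact: Rintegral_cot_kernel.
- by move=> z; exact: gram_conv_ge0.
Qed.

End conjugate_operator.

End truncated_kernel.

(** * The inequality *)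

Section cantelli_and_fatou.
Context d (T : measurableType d) (R : realType) (P : probability T R).

(** Markov's inequality for (g + u)^2. The variance enters through an upper bound N, so that one
    bound serves all truncations. *)
Lemma cantelli_mean0 (g : T -> R) (N c : R) : square_integrable P g ->
  \int[P]_x g x = 0 -> \int[P]_x g x ^+ 2 <= N -> 0 < c ->
  (P [set x | (c <= g x)%R] <= (N / (c ^+ 2 + N))%:E)%E.
Proof.
move=> sg g0 gN c0; have [mg g2i] := sg.
have gi := square_integrable_integ sg.
have N0 : 0 <= N by apply: le_trans gN; apply: Rintegral_ge0 => x _; exact: sqr_ge0.
set A := [set x | _]; have mA : measurable A.
  by rewrite -[A]setTI; exact: measurable_fun_le.
have PA : P A = (\int[P]_x \1_A x)%:E.
  by rewrite /Rintegral integral_indic// setIT fineK// fin_num_measure.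
rewrite PA lee_fin; set p := \int[P]_x _.
(* This shift minimizes (N + u^2) / (c + u)^2, with minimum N / (c^2 + N). *)
pose u := N / c.
have u0 : 0 <= u by rewrite divr_ge0// ltW.
have i1 : P.-integrable setT (EFin \o (fun x => 2 * u * g x + u ^+ 2)).
  by apply: integD; [exact: integZ|exact: integ_cst].
have : (c + u) ^+ 2 * p <= N + u ^+ 2.
  apply: (@le_trans _ _ (\int[P]_x (g x ^+ 2 + (2 * u * g x + u ^+ 2)))).
    rewrite -RintegralZl//; last exact: integrable_indic.
    apply: le_Rintegral => //.
    - exact/integZ/integrable_indic.
    - exact: integD.
    move=> x _; have -> : g x ^+ 2 + (2 * u * g x + u ^+ 2) = (g x + u) ^+ 2 by ring.
    rewrite indicE; case: (boolP (x \in A)) => [|_]; last by rewrite mulr0 sqr_ge0.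
    rewrite inE /A /= mulr1 => cx; apply: lerXn2r; rewrite ?nnegrE ?lerD2r// addr_ge0// ?ltW//.
    by rewrite (lt_le_trans c0).
  rewrite RintegralD// RintegralD//; [|exact: integZ|exact: integ_cst].
  by rewrite RintegralZl// g0 mulr0 add0r probability_Rintegral_cst lerD2r.
have c2N : 0 < c ^+ 2 + N by rewrite ltr_pwDl// exprn_gt0.
have -> : N + u ^+ 2 = N / (c ^+ 2 + N) * (c + u) ^+ 2.
  by rewrite /u; field; rewrite !gt_eqF.
by rewrite mulrC ler_pM2r// exprn_gt0// ltr_pwDl.
Qed.

(** The tails [B n] increase to the union and each lies in [A n]; continuity from below
    concludes. *)
Lemma measure_liminf_le (A : (set T)^nat) (c : \bar R) :
  (forall n, measurable (A n)) -> (forall n, (P (A n) <= c)%E) ->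
  (P (\bigcup_n \bigcap_(k >= n) A k) <= c)%E.
Proof.
move=> mA Ac; pose B n := \bigcap_(k >= n) A k.
have mB n : measurable (B n) by apply: bigcap_measurable => // ; exists n => /=.
have ndB : {homo B : n m / (n <= m)%N >-> (n <= m)%O}.
  move=> n m nm; apply/subsetPset => x Bx k /= mk; apply: Bx.
  exact: leq_trans mk.
have mUB : measurable (\bigcup_n B n) by exact: bigcup_measurable.
have cv := nondecreasing_cvg_mu mB mUB ndB (mu := P).
rewrite -(cvg_lim _ cv)//; apply: lime_le; first by apply/cvg_ex; exists (P (\bigcup_n B n)).
apply: nearW => n /=; apply: le_trans (Ac n).
by apply: le_measure; rewrite ?inE// => x /(_ n); apply => /=.
Qed.

End cantelli_and_fatou.

(** * Transfer between the circle and its angles *)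

Section circle_angles.
Context {R : realType}.
Implicit Types (e t s : R) (f : circle R -> R) (xi : circle R).

Lemma cos_eq1_small t : `|t| < pi *+ 2 -> cos t = 1 -> t = 0.
Proof.
move=> tpi ct; apply/eqP/negPn/negP => t0.
have := one_sub_cos t; rewrite ct subrr => /esym/eqP.
rewrite mulf_eq0 pnatr_eq0/= sqrf_eq0 => /eqP st.
have : 0 < sin (`|t| / 2).
  rewrite sin_gt0_pi// divr_gt0 ?normr_gt0//=.
  by rewrite ltr_pdivrMr// mulr_natr.
have [t0'|t0'] := leP 0 t; first by rewrite ger0_norm// st ltxx.
by rewrite ltr0_norm// mulNr sinN st oppr0 ltxx.
Qed.

Lemma expi_inj : {in `]- pi, pi] &, injective (@expi R)}.
Proof.
move=> t s; rewrite !in_itv/= => /andP[t1 t2] /andP[s1 s2].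
move=> /(congr1 (fun z => sval z)) /= [ct st].
apply/eqP; rewrite -subr_eq0; apply/eqP; apply: cos_eq1_small.
  by rewrite ltr_norml mulr2n; apply/andP; split; lra.
by rewrite cosB ct st -!expr2 cos2Dsin2.
Qed.

Lemma arg_expi t : t \in `]- pi, pi] -> arg (expi t) = t.
Proof.
move=> tI; rewrite /arg; case: xgetP => [s _ [sI /expi_inj]|/(_ t)[]] //.
exact.
Qed.

(** The squared chord is 2 (1 - cos (t - s)), which is why [far] can be stated with cosines. *)
Lemma far_chord e t s : 0 < e ->
  (e%:C < `|sval (expi t) - sval (expi s)|)%C = (cos (t - s) < 1 - e ^+ 2 / 2).
Proof.
move=> e0; rewrite normc_def /= ltcR.
have -> : (cos t - cos s) ^+ 2 + (sin t - sin s) ^+ 2 = 2 * (1 - cos (t - s)).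
  by have := cos2Dsin2 t; have := cos2Dsin2 s; rewrite cosB; lra.
rewrite -{1}(gtr0_norm e0) -sqrtr_sqr !ltNge ler_sqrt ?sqr_ge0//.
by congr (~~ _); apply/idP/idP; lra.
Qed.

Lemma integral_haar (g : circle R -> \bar R) :
  measurable_fun setT g -> (forall x, 0 <= g x)%E ->
  (\int[@haar R]_x g x = \int[angle_law]_t g (expi t))%E.
Proof.
move=> mg g0.
have mexpi : measurable_fun (setT : set (measurableTypeR R)) (@expi R).
  exact: measurable_expi.
have E := ge0_integral_pushforward mexpi angle_law measurableT mg (fun x _ => g0 x).
rewrite preimage_setT in E; rewrite -[RHS]E.
by apply: eq_measure_integral => A mA _.
Qed.

Lemma measurable_comp_expi f : measurable_fun setT f ->
  measurable_fun setT (f \o @expi R).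
Proof. by move=> mf; exact: measurableT_comp mf measurable_expi. Qed.

Lemma Lfun_haar_square f : f \in Lfun (@haar R) 2%:E ->
  square_integrable angle_law (f \o @expi R) /\
  \int[angle_law]_t f (expi t) ^+ 2 = L2norm f ^+ 2.
Proof.
move=> fL; have := Lfun2_integrable_sqr fL.
have mf : measurable_fun setT f by have /andP[] := fL; rewrite inE.
have mF := measurable_comp_expi mf.
have mf2 : measurable_fun setT (fun x => (f x ^+ 2)%:E).
  by apply/measurable_EFinP; exact: measurable_funX.
have int2 : (\int[@haar R]_x (f x ^+ 2)%:E = \int[angle_law]_t (f (expi t) ^+ 2)%:E)%E.
  by apply: integral_haar => // x; rewrite lee_fin sqr_ge0.
move=> /integrableP[_].
under eq_integral do rewrite gee0_abs ?lee_fin ?sqr_ge0//=.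
rewrite [X in (X < _)%E]int2 => fin; split.
  split => //; apply/integrableP; split.
    by apply/measurable_EFinP; exact: measurable_funX.
  by under eq_integral do rewrite gee0_abs ?lee_fin ?sqr_ge0//=.
have two0 : (2 : R) != 0 by rewrite pnatr_eq0.
have := poweR_Lnorm (@haar R) (EFin \o f) two0.
have Nfin : 'N[@haar R]_2%:E[EFin \o f]%E \is a fin_num.
  rewrite ge0_fin_numE ?Lnorm_ge0//.
  by have /andP[_] := fL; rewrite inE.
rewrite -{1}(fineK Nfin) poweR_EFin powR_mulrn ?fine_ge0 ?Lnorm_ge0//.
have -> : (\int[@haar R]_x `|(EFin \o f) x| `^ 2 = \int[@haar R]_x (f x ^+ 2)%:E)%E.
  apply: eq_integral => x _.
  by rewrite /= ?poweR_EFin powR_mulrn// real_normK// num_real.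
by rewrite int2 => /(congr1 fine) /esym.
Qed.

Lemma truncated_hilbertE e f t : 0 < e -> measurable_fun setT f ->
  t \in `]- pi, pi] ->
  truncated_hilbert e f (expi t) = conjugate e (f \o @expi R) t.
Proof.
move=> e0 mf tI; rewrite /truncated_hilbert /conjugate arg_expi//.
rewrite Rintegral_angle_law; last first.
  apply: measurable_funM; last exact: measurable_comp_expi.
  apply: (measurableT_comp (measurable_cot_kernel e)).
  exact: measurable_funB.
congr (_ * _); rewrite (_ : [set s | _] = `[- pi, pi]%classic `&`
    [set s | (e%:C < `|sval (expi t) - sval (expi s)|)%C])//.
rewrite Rintegral_mkcondr; apply: eq_Rintegral => s _.
rewrite patchE /cot_kernel /far -far_chord//.
set chord := [set _ | _]; set b := (_ < _)%C.
have -> : (s \in chord) = b by apply/idP/idP; rewrite inE.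
case: ifPn => _; last by rewrite !mul0r.
by rewrite mul1r mulrC.
Qed.

End circle_angles.

Section upper_bound.
Context {R : realType}.

(** Lebesgue measure is an outer measure on arbitrary sets, hence monotone there; this is how level
    sets of [hilbert] are compared with measurable sets. *)
Lemma le_angle_law (A B : set R) : A `&` `]- pi, pi]%classic `<=` B ->
  (angle_law A <= angle_law B)%E.
Proof.
move=> AB; rewrite !angle_lawE lee_wpmul2l ?lee_fin ?inv_2pi_ge0//.
by apply: le_mu_ext => x [Ax Ix]; split => //; apply: AB.
Qed.

Lemma harmonic_at_right (g : R -> R) (l : R) : g x @[x --> 0^'+] --> l ->
  g (harmonic n) @[n --> \oo] --> l.
Proof.
move=> /cvg_at_rightP; apply; split => [n|]; last exact: cvg_harmonic.
by rewrite invr_gt0.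
Qed.

(* Where the principal value does not exist, [lim] returns 0, which is below 1;
   hence its existence almost everywhere is not needed. *)
Lemma haar_hilbert_le (f : circle R -> R) : f \in Lfun (@haar R) 2%:E ->
  (haar [set xi | (1 <= hilbert f xi)%R]
    <= (L2norm f ^+ 2 / (1 + L2norm f ^+ 2))%:E)%E.
Proof.
move=> fL; have [sF FN] := Lfun_haar_square fL.
have mf : measurable_fun setT f by have /andP[] := fL; rewrite inE.
set F := f \o _ in sF; set N := L2norm f ^+ 2 in FN *.
have N0 : 0 <= N by exact: sqr_ge0.
have Fi := square_integrable_integ sF.
rewrite haarE; set S := _ @^-1` _.
(* The margin r turns a limit that is at least 1 into values eventually above 1 - r. *)
have step (r : R) : 0 < r < 1 ->
    (angle_law S <= (N / ((1 - r) ^+ 2 + N))%:E)%E.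
  move=> /andP[r0 r1].
  pose A n : set (measurableTypeR R) := [set t | 1 - r <= conjugate (harmonic n) F t].
  have h0 n : 0 < harmonic n :> R by rewrite invr_gt0.
  have mc n : measurable_fun setT (conjugate (harmonic n) F).
    exact: measurable_conjugate.
  have mA n : measurable (A n).
    rewrite -[A n]setTI; apply: measurable_fun_le => //; exact: mc.
  apply: (@le_trans _ _ (angle_law (\bigcup_n \bigcap_(k >= n) A k))).
    apply: le_angle_law => t [St tI].
    have : 1 <= hilbert f (expi t) by [].
    rewrite /hilbert; set u := (X in lim X) => lim1.
    have cu : cvg u.
      apply: cvgNpoint; apply/eqP => lim0.
      by move: lim1; rewrite lim0 (_ : point = 0)// ler10.
    have lim1r : 1 - r < lim u by apply: lt_le_trans lim1; rewrite ltrBlDr ltrDl.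
    have [n _ Hn] := cvgr_gt _ (harmonic_at_right cu) _ lim1r.
    exists n => // k /= nk; rewrite /A /= ltW//.
    have := Hn k nk; rewrite /= truncated_hilbertE//.
  apply: measure_liminf_le => // n; apply: cantelli_mean0.
  - apply: (@square_integrable_bounded _ _ _ _ _
      (2 / harmonic n * \int[angle_law]_s `|F s|)).
      exact: mc.
    by move=> t; apply: conjugate_bounded.
  - exact: conjugate_mean0.
  - by rewrite -FN; exact: conjugate_contraction.
  - by rewrite subr_gt0.
have den (r : R) : 0 < r < 1 -> 0 < (1 - r) ^+ 2 + N.
  by move=> /andP[_ r1]; rewrite ltr_pwDl// exprn_gt0// subr_gt0.
have half01 : 0 < (2^-1 : R) < 1 by apply/andP; split; lra.
have fin : angle_law S \is a fin_num.
  rewrite ge0_fin_numE ?measure_ge0//; apply: le_lt_trans (step _ half01) _.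
  exact: ltry.
rewrite -(fineK fin) lee_fin; set m := fine _.
have m0 : 0 <= m by rewrite fine_ge0// measure_ge0.
have mstep (r : R) : 0 < r < 1 -> m * ((1 - r) ^+ 2 + N) <= N.
  move=> r01; have := step r r01; rewrite -(fineK fin) lee_fin.
  by rewrite ler_pdivlMr// den.
have m1 : m <= 1.
  have := mstep _ half01; have := den _ half01; nra.
rewrite ler_pdivlMr; last by rewrite ltr_pwDl.
rewrite leNgt; apply/negP => lt.
(* Since m <= 1, [mstep] bounds the gap m (1 + N) - N by 2 r, which is at most half the gap. *)
pose r := Num.min (2^-1 : R) ((m * (1 + N) - N) / 4).
have r0 : 0 < r by rewrite lt_min invr_gt0 ltr0n/= divr_gt0// subr_gt0.
have rh : r <= 2^-1 by rewrite ge_min lexx.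
have rq : r <= (m * (1 + N) - N) / 4 by rewrite ge_min lexx orbT.
have r01 : 0 < r < 1 by apply/andP; split; lra.
by have := mstep r r01; nra.
Qed.

End upper_bound.

(** * Inversion of the truncated conjugation operator *)

Section composition_estimate.
Context {R : realType}.
Implicit Types (e d x t s y : R).

(** Normalized length of the removed arc, the unit in which all truncation errors below are
    measured. *)
Definition near_mass e : R := \int[angle_law]_s (1 - far e s).

Lemma far_norm e x : `|far e x| <= 1.
Proof. by have /andP[? ?] := far01 e x; rewrite ger0_norm. Qed.

Lemma near01 e x : 0 <= 1 - far e x <= 1.
Proof. by have /andP[? ?] := far01 e x; apply/andP; split; lra. Qed.

Lemma near_norm e x : `|1 - far e x| <= 1.
Proof. by have /andP[? ?] := near01 e x; rewrite ger0_norm. Qed.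

Lemma far_cases e x : far e x = 0 \/ far e x = 1.
Proof. by rewrite /far; case: ifP; [right|left]. Qed.

Lemma measurable_near e : measurable_fun setT (fun x => 1 - far e x).
Proof. by apply: measurable_funB => //; exact: measurable_far. Qed.

Lemma measurable_reflect (g : R -> R) t : measurable_fun setT g ->
  measurable_fun setT (fun s : R => g (t - s)).
Proof. by move=> mg; apply: (measurableT_comp mg); exact: measurable_funB. Qed.

Lemma measurable_translate (g : R -> R) t : measurable_fun setT g ->
  measurable_fun setT (fun s : R => g (s - t)).
Proof. by move=> mg; apply: (measurableT_comp mg); exact: measurable_funB. Qed.

Lemma integ_near e (g : R -> R) : measurable_fun setT g ->
  angle_law.-integrable setT (EFin \o (fun s => 1 - far e (g s))).
Proof.
move=> mg; apply: (@integ_bounded _ _ _ _ _ 1) => [|s]; last exact: near_norm.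
exact: (measurableT_comp (measurable_near e) mg).
Qed.

Lemma near_mass_ge0 e : 0 <= near_mass e.
Proof. by apply: Rintegral_ge0 => s _; have /andP[] := near01 e s. Qed.

Lemma near_mass_reflect e t : \int[angle_law]_s (1 - far e (t - s)) = near_mass e.
Proof.
apply: (Rintegral_angle_law_reflect t (measurable_near e)) => x.
by rewrite periodic_far.
Qed.

Lemma near_mass_translate e t : \int[angle_law]_s (1 - far e (s - t)) = near_mass e.
Proof.
apply: (Rintegral_angle_lawD (- t) (measurable_near e)) => x.
by rewrite periodic_far.
Qed.

Lemma near_sin e x : 0 <= e -> far e x = 0 -> `|sin (x / 2)| <= e / 2.
Proof.
move=> e0; rewrite /far; case: ifPn => [_ /eqP|]; first by rewrite oner_eq0.
rewrite -leNgt => cx _; have := one_sub_cos x => E.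
rewrite -(@ler_pXn2r _ 2)// ?nnegrE ?normr_ge0 ?divr_ge0//.
by rewrite real_normK ?num_real// expr_div_n; lra.
Qed.

Lemma cotM1D (a b : R) : sin a != 0 -> sin b != 0 -> sin (a + b) != 0 ->
  cot a * cot b = 1 + cot (a + b) * (cot a + cot b).
Proof.
move=> sa sb sab; have := @cotM1 _ a (- b) sa; rewrite sinN oppr_eq0 opprK.
by move=> /(_ sb sab); rewrite /cot sinN cosN invrN mulrN; lra.
Qed.

Section kernel_composition.
Variables (e d eta t y : R).
Hypotheses (e0 : 0 < e) (d0 : 0 < d) (e_eta : e <= eta / 2) (d_eta : d <= eta / 2).
Hypothesis ty : far eta (t - y) != 0.

Let eta0 : 0 < eta.
Proof. by have := lt_le_trans e0 e_eta; lra. Qed.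

Let sin_ty : eta / 2 < `|sin ((t - y) / 2)| := far_sin (ltW eta0) ty.

(** Triangle inequality for chords: t - y spans more than eta and b at most eta / 2, which leaves at
    least eta / 2 for a. *)
Let far_from_near (a b c : R) : 0 < c -> c <= eta / 2 -> (t - y) / 2 = (a + b) / 2 ->
  far c b = 0 -> eta / 4 <= `|sin (a / 2)|.
Proof.
move=> c0 ce tyE /(near_sin (ltW c0)) sb; have := sin_ty; rewrite tyE mulrDl sinD => s1.
have h1 : `|sin (a / 2) * cos (b / 2) + cos (a / 2) * sin (b / 2)| <=
    `|sin (a / 2)| + `|sin (b / 2)|.
  apply: (le_trans (ler_normD _ _)); rewrite !normrM lerD//.
    by rewrite -[leRHS]mulr1 ler_wpM2l// ler_norml cos_geN1 cos_le1.
  by rewrite -[leRHS]mul1r ler_wpM2r// ler_norml cos_geN1 cos_le1.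
lra.
Qed.

(** The kernel has mean zero, so [far c] may be replaced by [far c] - 1, supported where B is short.
    There A is long and the cotangent is at most 4 / eta, a bound that stays finite as p tends to
    0. *)
Let bound_one (p c : R) (A B : R -> R) : 0 < p -> 0 < c -> c <= eta / 2 ->
  measurable_fun setT A -> measurable_fun setT B ->
  (forall s, (t - y) / 2 = (A s + B s) / 2) ->
  (\int[angle_law]_s cot_kernel p (A s) = 0) ->
  (\int[angle_law]_s (1 - far c (B s)) = near_mass c) ->
  `|\int[angle_law]_s (cot_kernel p (A s) * far c (B s))| <= 4 / eta * near_mass c.
Proof.
move=> p0 c0 ce mA mB AB intA intB.
have mk : measurable_fun setT (fun s => cot_kernel p (A s)).
  exact: (measurableT_comp (measurable_cot_kernel p) mA).
have ik : angle_law.-integrable setT (EFin \o (fun s => cot_kernel p (A s))).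
  by apply: (@integ_bounded _ _ _ _ _ (2 / p)) => // s; exact: cot_kernel_bounded.
have inear := integ_near c mB.
have ikn : angle_law.-integrable setT
    (EFin \o (fun s => cot_kernel p (A s) * (1 - far c (B s)))).
  by apply: (@integM_bounded _ _ _ angle_law _ _ (2 / p)) => // s; exact: cot_kernel_bounded.
have -> : \int[angle_law]_s (cot_kernel p (A s) * far c (B s)) =
    - \int[angle_law]_s (cot_kernel p (A s) * (1 - far c (B s))).
  rewrite -[LHS]subr0 -[LHS]opprK opprB; congr (- _).
  rewrite -{1}intA -RintegralB//.
    by apply: eq_Rintegral => s _; ring.
  have := integB ik ikn; apply: eq_integrable => // s _ /=; congr EFin; ring.
rewrite normrN; apply: (le_trans (le_normr_Rintegral measurableT ikn)).
rewrite -intB -RintegralZl//; apply: le_Rintegral => //.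
- exact: integ_norm.
- exact: integZ.
move=> s _; rewrite normrM (ger0_norm (x := 1 - far c (B s))); last first.
  by have /andP[] := near01 c (B s).
have [fB|->] := far_cases c (B s); last by rewrite subrr !mulr0.
rewrite ler_wpM2r//; first by have /andP[] := near01 c (B s).
have := norm_cot_le _ (far_from_near c0 ce (AB s) fB).
rewrite divr_gt0// invf_div => /(_ isT); apply: le_trans.
rewrite /cot_kernel normrM -[leRHS]mul1r ler_wpM2r//.
exact: far_norm.
Qed.

(** The half-angles of t - s and s - y add up to that of t - y, so the cotangent of the sum is a
    constant [c] with |c| <= 2 / eta. The product of truncations tends to 1 and gives the constant
    1; the two single cotangent integrals fall under [bound_one] and give 8 / eta^2 = (2 / eta) (4 /
    eta). *)
Lemma cot_kernel_composition :
  `|\int[angle_law]_s (cot_kernel d (s - y) * cot_kernel e (t - s)) - 1| <=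
  (1 + 8 / eta ^+ 2) * (near_mass e + near_mass d).
Proof.
have mts : measurable_fun setT (fun s : R => t - s) by exact: measurable_funB.
have msy : measurable_fun setT (fun s : R => s - y) by exact: measurable_funB.
have mf1 : measurable_fun setT (fun s : R => far e (t - s)).
  exact: measurable_reflect (measurable_far e).
have mf2 : measurable_fun setT (fun s : R => far d (s - y)).
  exact: measurable_translate (measurable_far d).
have mk1 : measurable_fun setT (fun s : R => cot_kernel e (t - s)).
  exact: measurable_reflect (measurable_cot_kernel e).
have mk2 : measurable_fun setT (fun s : R => cot_kernel d (s - y)).
  exact: measurable_translate (measurable_cot_kernel d).
have ff s : `|far e (t - s) * far d (s - y)| <= 1.
  by rewrite normrM -[leRHS]mulr1 ler_pM// far_norm.
have i1 : angle_law.-integrable setT (EFin \o (fun s => far e (t - s) * far d (s - y))).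
  apply: (@integ_bounded _ _ _ _ _ 1) => //; exact: measurable_funM.
have i2 : angle_law.-integrable setT (EFin \o (fun s => cot_kernel e (t - s) * far d (s - y))).
  apply: (@integ_bounded _ _ _ _ _ (2 / e)); first exact: measurable_funM.
  by move=> s; rewrite normrM -[leRHS]mulr1 ler_pM// ?far_norm// cot_kernel_bounded.
have i3 : angle_law.-integrable setT (EFin \o (fun s => cot_kernel d (s - y) * far e (t - s))).
  apply: (@integ_bounded _ _ _ _ _ (2 / d)); first exact: measurable_funM.
  by move=> s; rewrite normrM -[leRHS]mulr1 ler_pM// ?far_norm// cot_kernel_bounded.
set c := cot ((t - y) / 2).
have E : \int[angle_law]_s (cot_kernel d (s - y) * cot_kernel e (t - s)) =
  \int[angle_law]_s (far e (t - s) * far d (s - y)) +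
  c * (\int[angle_law]_s (cot_kernel e (t - s) * far d (s - y)) +
       \int[angle_law]_s (cot_kernel d (s - y) * far e (t - s))).
  rewrite -RintegralD// -RintegralZl//; last exact: integD.
  rewrite -RintegralD//; last exact/integZ/integD.
  apply: eq_Rintegral => s _; rewrite /cot_kernel.
  have [f1|f1] := eqVneq (far e (t - s)) 0; first by rewrite f1 !(mul0r, mulr0, addr0).
  have [f2|f2] := eqVneq (far d (s - y)) 0; first by rewrite f2 !(mul0r, mulr0, addr0).
  have := cotM1D (far_sin_neq0 (ltW e0) f1) (far_sin_neq0 (ltW d0) f2).
  have -> : (t - s) / 2 + (s - y) / 2 = (t - y) / 2 by field.
  move=> /(_ (far_sin_neq0 (ltW eta0) ty)) H.
  transitivity (far e (t - s) * far d (s - y) * (cot ((t - s) / 2) * cot ((s - y) / 2))).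
    by ring.
  by rewrite H -/c; ring.
have b2 : `|\int[angle_law]_s (cot_kernel e (t - s) * far d (s - y))| <= 4 / eta * near_mass d.
  apply: bound_one => //.
  - by move=> s; field.
  - exact: Rintegral_cot_kernel.
  - exact: near_mass_translate.
have b3 : `|\int[angle_law]_s (cot_kernel d (s - y) * far e (t - s))| <= 4 / eta * near_mass e.
  apply: bound_one => //.
  - by move=> s; field.
  - have := Rintegral_angle_lawD (- y) (measurable_cot_kernel d) (@periodic_cot_kernel _ d).
    rewrite -(Rintegral_cot_kernel 0 d0) => ->.
    by rewrite -(Rintegral_angle_lawN (measurable_cot_kernel d));
      apply: eq_Rintegral => s _; rewrite sub0r.
  - exact: near_mass_reflect.
have b1 : `|\int[angle_law]_s (far e (t - s) * far d (s - y)) - 1| <= near_mass e + near_mass d.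
  rewrite -[X in _ - X](@probability_Rintegral_cst _ _ _ angle_law 1) -RintegralB//;
    last exact: integ_cst.
  have i4 := integB i1 (integ_cst angle_law 1).
  apply: (le_trans (le_normr_Rintegral measurableT i4)).
  rewrite -(near_mass_reflect e t) -(near_mass_translate d y) -RintegralD//;
    [|exact: integ_near|exact: integ_near].
  apply: le_Rintegral => //.
  - exact: integ_norm i4.
  - by apply: integD; exact: integ_near.
  move=> s _; have [->|->] := far_cases e (t - s); have [->|->] := far_cases d (s - y);
   rewrite ?(mul0r, mul1r, mulr0, sub0r, subrr, subr0, normrN, normr1, normr0); lra.
have cb : `|c| <= 2 / eta.
  by have := norm_cot_le _ (ltW sin_ty); rewrite divr_gt0// invf_div => /(_ isT).
rewrite E addrAC; apply: (le_trans (ler_normD _ _)); rewrite mulrDl mul1r lerD//.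
rewrite normrM; have -> : 8 / eta ^+ 2 * (near_mass e + near_mass d) =
  2 / eta * (4 / eta * near_mass d + 4 / eta * near_mass e) by field; rewrite gt_eqF.
by rewrite ler_pM//; apply: (le_trans (ler_normD _ _)); rewrite lerD.
Qed.

End kernel_composition.

End composition_estimate.

Section near_mass_limit.
Context {R : realType}.
Implicit Types (e d x t s y : R).

Lemma far_neq0E e x : (far e x != 0) = (cos x < 1 - e ^+ 2 / 2).
Proof. by rewrite /far; case: ifPn; rewrite ?oner_neq0 ?eqxx. Qed.

Lemma far_neq0 e x : far e x != 0 -> far e x = 1.
Proof. by case: (far_cases e x) => ->; rewrite ?eqxx. Qed.

Lemma far_le d e x : 0 <= d -> d <= e -> far e x != 0 -> far d x != 0.
Proof.
move=> d0 de; rewrite !far_neq0E => /lt_le_trans; apply.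
have : d ^+ 2 <= e ^+ 2 by rewrite lerXn2r// nnegrE (le_trans d0).
by lra.
Qed.

Lemma harmonic_gt0 n : 0 < harmonic n :> R.
Proof. by rewrite invr_gt0. Qed.

Lemma far_harmonic x : cos x < 1 -> \forall n \near \oo, far (harmonic n) x != 0.
Proof.
move=> cx; have c0 : 0 < 1 - cos x by rewrite subr_gt0.
near=> n; rewrite far_neq0E.
have h1 : harmonic n <= 1 :> R by rewrite invf_le1// ler1n.
have h0 := harmonic_gt0 n.
have : harmonic n < 1 - cos x by near: n; exact: (cvgr_lt _ (@cvg_harmonic R)).
nra.
Unshelve. all: by end_near. Qed.

(** Dominated convergence: the removed arcs shrink to the set cos s = 1, which is null. *)
Lemma near_mass_cvg : @near_mass R (harmonic n) @[n --> \oo] --> 0.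
Proof.
pose g (s : measurableTypeR R) : R := \1_[set s | cos s = 1] s.
have mZ : measurable ([set s | cos s = 1] : set (measurableTypeR R)).
  have mc : measurable_fun setT (@cos R).
    by apply: continuous_measurable_fun; exact: continuous_cos.
  rewrite -[X in measurable X]setTI; exact: (mc measurableT _ (measurable_set1 1)).
have Z0 : @angle_law R [set s | cos s = 1] = (0 : \bar R)%E.
  apply/eqP; rewrite eq_le measure_ge0 andbT -(angle_law_set1 0).
  apply: le_angle_law => s /= [cs]; rewrite in_itv/= => /andP[s1 s2].
  apply: cos_eq1_small => //; rewrite ltr_norml mulr2n; have := pi_gt0 R.
  by move=> pi0; apply/andP; split; lra.
have cvg_int := @dominated_cvg _ _ _ angle_law setT measurableT
  (fun n s => (1 - far (harmonic n) s)%:E) (EFin \o g) (EFin \o (fun=> 1)).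
have : (\int[angle_law]_s (1 - far (harmonic n) s)%:E @[n --> \oo] -->
    \int[angle_law]_s (g s)%:E)%E.
  apply: cvg_int => //.
  - by move=> n; apply/measurable_EFinP; exact: measurable_near.
  - move=> s _; rewrite /g/= indicE; apply: cvg_near_cst.
    have [cs|cs] := eqVneq (cos s) 1.
      rewrite mem_set//; apply: nearW => n; congr EFin.
      rewrite /far ifF ?subr0//; apply/negbTE; rewrite -leNgt cs.
      by rewrite gerBl divr_ge0 ?sqr_ge0.
    have -> : (s \in [set s | cos s = 1]) = false.
      by apply/negbTE; rewrite notin_setE; exact/eqP.
    have : cos s < 1 by rewrite lt_neqAle cs cos_le1.
    move=> /far_harmonic; apply: filterS => n /far_neq0 ->.
    by rewrite subrr.
  - exact: integ_cst.
  - by move=> n s _; rewrite /= lee_fin; exact: near_norm.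
have -> : (\int[angle_law]_s (g s)%:E = (0%R)%:E)%E.
  by rewrite integral_indic// setIT; exact: Z0.
by move=> /fine_cvg.
Qed.

Lemma near_mass_le d e : 0 <= d -> d <= e -> near_mass d <= near_mass e.
Proof.
move=> d0 de; apply: le_Rintegral => //; try exact: (integ_near _ (@measurable_id _ _ setT)).
move=> x _; have [fe|fe] := far_cases e x.
  by rewrite fe subr0; have /andP[] := near01 d x.
have : far d x != 0 by apply: (far_le d0 de); rewrite fe oner_neq0.
by move=> /far_neq0 ->; rewrite fe.
Qed.

Lemma near_mass_small (r : R) : 0 < r ->
  exists2 e, 0 < e & forall d, 0 <= d -> d <= e -> near_mass d < r.
Proof.
move=> r0; have [n _ Hn] := cvgr_lt _ near_mass_cvg _ r0.
exists (harmonic n); first exact: harmonic_gt0.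
by move=> d d0 dn; apply: le_lt_trans (near_mass_le d0 dn) (Hn n (leqnn n)).
Qed.

End near_mass_limit.

(** * Truncations of a function that is constant between two jumps *)

Section conjugate_inversion.
Context {R : realType}.
Variables (u : R -> R) (M a : R).
Hypothesis mu : measurable_fun setT u.
Hypothesis uM : forall s, `|u s| <= M.

(* The point of angle t is at distance more than e from those of angle a, -a. *)
Definition away e t : bool := (far e (t - a) != 0) && (far e (t + a) != 0).

Hypothesis u_locally_constant :
  forall e t s, away e t -> far e (t - s) = 0 -> u s = u t.

Implicit Types (e d t s : R).

Let M0 : 0 <= M. Proof. exact: le_trans (uM 0). Qed.

Let ui : angle_law.-integrable setT (EFin \o u).
Proof. exact: (@integ_bounded _ _ _ angle_law u M mu uM). Qed.

Let su : square_integrable angle_law u.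
Proof. exact: (@square_integrable_bounded _ _ _ angle_law u M mu uM). Qed.

Let ik e t : 0 < e -> angle_law.-integrable setT
  (EFin \o (fun s => cot_kernel e (t - s))).
Proof. exact: integ_cot_kernel. Qed.

Let integ_conj e t (g : R -> R) : 0 < e -> angle_law.-integrable setT (EFin \o g) ->
  angle_law.-integrable setT (EFin \o (fun s => cot_kernel e (t - s) * g s)).
Proof.
move=> e0; apply: (integ_kernel (measurable_cot_conv e)) => z.
exact: cot_kernel_bounded.
Qed.

Lemma away_le d e t : 0 <= d -> d <= e -> away e t -> away d t.
Proof.
by move=> d0 de /andP[f1 f2]; rewrite /away !(far_le d0 de).
Qed.

(** The two kernels differ only within distance e of t, where u equals u t. The difference is thus u
    t times a difference of kernel means, which are 0. *)
Lemma conjugate_stable d e t : 0 < d -> d <= e -> away e t ->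
  conjugate d u t = conjugate e u t.
Proof.
move=> d0 de et; have e0 : 0 < e by exact: lt_le_trans de.
apply/eqP; rewrite -subr_eq0 /conjugate -RintegralB//; [|exact: integ_conj|exact: integ_conj].
rewrite (_ : \int[angle_law]_s _ =
  \int[angle_law]_s (u t * (cot_kernel d (t - s) - cot_kernel e (t - s)))); last first.
  apply: eq_Rintegral => s _; rewrite -mulrBl mulrC /cot_kernel.
  have [fe|fe] := eqVneq (far e (t - s)) 0.
    by rewrite (u_locally_constant et fe).
  by rewrite (far_neq0 fe) (far_neq0 (far_le (ltW d0) de fe)) subrr !mulr0.
rewrite RintegralZl//; last by apply: integB; exact: ik.
rewrite RintegralB//; [|exact: ik|exact: ik].
by rewrite !Rintegral_cot_kernel// subrr mulr0.
Qed.

(** The two truncation factors kill the sequence while the removed arc around t still reaches a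
    jump. It therefore converges everywhere: it is eventually constant away from the jumps and zero
    at them. *)
Let v n t := far (harmonic n) (t - a) * far (harmonic n) (t + a) *
  conjugate (harmonic n) u t.

Definition conjugate_limit t : R := lim (v n t @[n --> \oo]).

Let v_away n t : away (harmonic n) t -> v n t = conjugate (harmonic n) u t.
Proof. by move=> /andP[/far_neq0 f1 /far_neq0 f2]; rewrite /v f1 f2 !mul1r. Qed.

Let v_near n t : ~~ away (harmonic n) t -> v n t = 0.
Proof.
by rewrite negb_and !negbK => /orP[] /eqP f0; rewrite /v f0 ?(mulr0, mul0r).
Qed.

Let v_cvg t l : (\forall n \near \oo, v n t = l) -> v n t @[n --> \oo] --> l.
Proof. exact: cvg_near_cst. Qed.

Lemma conjugate_limitE e t : 0 < e -> away e t ->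
  conjugate_limit t = conjugate e u t.
Proof.
move=> e0 et; apply/cvg_lim => //; apply: v_cvg.
have : \forall n \near \oo, (harmonic n : R) < e.
  exact: (cvgr_lt _ (@cvg_harmonic R)).
apply: filterS => n /ltW he; rewrite v_away.
  exact: conjugate_stable (harmonic_gt0 n) he et.
by apply: away_le et => //; exact/ltW/harmonic_gt0.
Qed.

Let v_conjugate_limit t : v n t @[n --> \oo] --> conjugate_limit t.
Proof.
have [[n nt]|nt] := pselect (exists n, away (harmonic n) t).
  apply: (@cvgP _ _ (conjugate (harmonic n) u t)); apply: v_cvg.
  exists n => // k /= nk.
  have kn : harmonic k <= harmonic n :> R by rewrite lef_pV2 ?posrE// ler_nat ltnS.
  rewrite v_away; last by apply: away_le nt => //; exact/ltW/harmonic_gt0.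
  exact: conjugate_stable (harmonic_gt0 k) kn nt.
apply: (@cvgP _ _ 0); apply: v_cvg; apply: nearW => n; apply: v_near.
by apply/negP => nt'; apply: nt; exists n.
Qed.

Let mv n : measurable_fun setT (v n).
Proof.
apply: measurable_funM; last exact: measurable_conjugate (harmonic_gt0 n) ui.
apply: measurable_funM; apply: (measurableT_comp (measurable_far _)).
  exact: measurable_funB.
exact: measurable_funD.
Qed.

Lemma measurable_conjugate_limit : measurable_fun setT conjugate_limit.
Proof. by apply: measurable_fun_cvg mv _ => t _; exact: v_conjugate_limit. Qed.

Lemma periodic_conjugate_limit : periodic conjugate_limit (pi *+ 2).
Proof.
move=> t; rewrite /conjugate_limit; suff -> : v ^~ (t + pi *+ 2) = v ^~ t by [].
apply/funext => n; rewrite /v (addrAC t _ (- a)) (addrAC t _ a) !periodic_far; congr (_ * _).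
rewrite /conjugate; apply: eq_Rintegral => s _.
by rewrite addrAC periodic_cot_kernel.
Qed.

Lemma square_integrable_conjugate e : 0 < e ->
  square_integrable angle_law (conjugate e u).
Proof.
move=> e0; apply: (@square_integrable_bounded _ _ _ _ _
  (2 / e * \int[angle_law]_s `|u s|)).
  exact: measurable_conjugate.
by move=> t; exact: conjugate_bounded.
Qed.

Let v_le n t : v n t ^+ 2 <= conjugate (harmonic n) u t ^+ 2.
Proof.
have [nt|nt] := boolP (away (harmonic n) t); first by rewrite v_away.
by rewrite v_near// expr0n sqr_ge0.
Qed.

Lemma conjugate_limit_square :
  square_integrable angle_law conjugate_limit /\
  \int[angle_law]_t conjugate_limit t ^+ 2 <= \int[angle_law]_t u t ^+ 2.
Proof.
have ml := measurable_conjugate_limit.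
have mv2 n : measurable_fun (setT : set (measurableTypeR R)) (fun t => (v n t ^+ 2)%:E).
  by apply/measurable_EFinP; exact: (measurable_funX 2 (mv n)).
have le n : (\int[angle_law]_t (v n t ^+ 2)%:E <= (\int[angle_law]_t u t ^+ 2)%:E)%E.
  have h0 := @harmonic_gt0 R n; have [mc c2i] := square_integrable_conjugate h0.
  apply: (@le_trans _ _ (\int[angle_law]_t (conjugate (harmonic n) u t ^+ 2)%:E)%E).
    apply: ge0_le_integral => //.
    - by move=> t _; rewrite lee_fin; exact: sqr_ge0.
    - by apply/measurable_EFinP; exact: measurable_funX.
    - by move=> t _; rewrite lee_fin v_le.
  rewrite [leLHS](_ : _ = (\int[angle_law]_t conjugate (harmonic n) u t ^+ 2)%:E).
    by rewrite lee_fin; exact: conjugate_contraction.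
  by rewrite /Rintegral fineK//; exact: (integrable_fin_num measurableT c2i).
have fatou_le : (\int[angle_law]_t (conjugate_limit t ^+ 2)%:E <=
    (\int[angle_law]_t u t ^+ 2)%:E)%E.
  have -> : (\int[angle_law]_t (conjugate_limit t ^+ 2)%:E =
      \int[angle_law]_t limn_einf ((fun n t => (v n t ^+ 2)%:E) ^~ t))%E.
    apply: eq_integral => t _; apply/esym.
    have : (v n t ^+ 2)%:E @[n --> \oo] --> (conjugate_limit t ^+ 2)%:E.
      by apply: cvg_EFin; [exact: nearW|apply: cvgM; exact: v_conjugate_limit].
    by move=> /cvg_limn_einf_sup[].
  apply: (le_trans (fatou angle_law measurableT mv2 _)).
    by move=> n t _; rewrite lee_fin sqr_ge0.
  rewrite limn_einf_lim; apply: lime_le; first exact: is_cvg_einfs.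
  apply: nearW => n; apply: le_trans (le n).
  by apply: ereal_inf_lbound; exists n => /=.
have l2i : angle_law.-integrable setT (EFin \o (fun t => conjugate_limit t ^+ 2)).
  apply/integrableP; split.
    by apply/measurable_EFinP; exact: measurable_funX.
  under eq_integral do rewrite gee0_abs ?lee_fin ?sqr_ge0//=.
  exact: le_lt_trans fatou_le (ltry _).
split; first by [].
rewrite -lee_fin; apply: le_trans fatou_le; rewrite {1}/Rintegral fineK//.
exact: (integrable_fin_num measurableT l2i).
Qed.

Let V := \int[angle_law]_t u t ^+ 2.

(* [conjugate_limit] and [conjugate d u] differ only on the two arcs of radius
   d around the angles a and -a; there AM-GM trades the L2 bounds against the
   length of the arcs. *)
Lemma conjugate_limit_L1 d lam : 0 < d -> 0 < lam ->
  \int[angle_law]_t `|conjugate_limit t - conjugate d u t| <=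
  4 * V * lam + near_mass d / (2 * lam).
Proof.
move=> d0 lam0; have [sl lV] := conjugate_limit_square.
have sc := square_integrable_conjugate d0.
have cV : \int[angle_law]_t conjugate d u t ^+ 2 <= V by exact: conjugate_contraction.
have [ml l2] := sl; have [mc c2] := sc.
have il : angle_law.-integrable setT (EFin \o (fun t => 1 - far d (t - a))).
  by apply: integ_near; exact: measurable_funB.
have ir : angle_law.-integrable setT (EFin \o (fun t => 1 - far d (t + a))).
  by apply: integ_near; exact: measurable_funD.
have i2 := integZ (2 * lam) (integD l2 c2).
have i1 := integZ (4 * lam)^-1 (integD il ir).
have -> : 4 * V * lam + near_mass d / (2 * lam) =
  2 * lam * (V + V) + (4 * lam)^-1 * (near_mass d + near_mass d).
  by field; rewrite gt_eqF.
(* Pointwise |x - y| <= lam (x - y)^2 + 1 / (4 lam) by completing the square, and (x - y)^2 <= 2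
   (x^2 + y^2). On the two arcs at least one of the near factors is 1. *)
apply: (@le_trans _ _ (\int[angle_law]_t (2 * lam * (conjugate_limit t ^+ 2 + conjugate d u t ^+ 2)
    + (4 * lam)^-1 * ((1 - far d (t - a)) + (1 - far d (t + a)))))).
  apply: le_Rintegral => //.
  - exact/integ_norm/(square_integrable_integ (square_integrableB sl sc)).
  - exact: integD i2 i1.
  move=> t _; have [dt|dt] := boolP (away d t).
    rewrite (conjugate_limitE d0 dt) subrr normr0.
    have /andP[n1 _] := near01 d (t - a); have /andP[n2 _] := near01 d (t + a).
    apply: addr_ge0; apply: mulr_ge0.
    - by rewrite mulr_ge0// ltW.
    - by rewrite addr_ge0 ?sqr_ge0.
    - by rewrite invr_ge0 mulr_ge0// ltW.
    - exact: addr_ge0.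
  have : 1 <= (1 - far d (t - a)) + (1 - far d (t + a)).
    move: dt; rewrite negb_and !negbK => /orP[] /eqP ->.
      by have /andP[] := near01 d (t + a); lra.
    by have /andP[] := near01 d (t - a); lra.
  move: (_ + _) => w w1; set x := conjugate_limit t; set y := conjugate d u t.
  have k0 : 0 < (4 * lam)^-1 by rewrite invr_gt0 mulr_gt0.
  apply: (@le_trans _ _ (lam * (x - y) ^+ 2 + (4 * lam)^-1)); last first.
    apply: lerD; last by rewrite ler_peMr// ltW.
    have -> : 2 * lam * (x ^+ 2 + y ^+ 2) = lam * (x - y) ^+ 2 + lam * (x + y) ^+ 2 by ring.
    by rewrite lerDl mulr_ge0 ?sqr_ge0// ltW.
  rewrite -[X in lam * X](@real_normK _ (x - y)) ?num_real//.
  rewrite -subr_ge0; set z := `|x - y|.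
  have -> : lam * z ^+ 2 + (4 * lam)^-1 - z = lam * (z - (2 * lam)^-1) ^+ 2.
    by field; rewrite gt_eqF.
  by rewrite mulr_ge0 ?sqr_ge0// ltW.
rewrite RintegralD//; rewrite RintegralZl//; last exact: integD l2 c2.
rewrite RintegralZl//; last exact: integD il ir.
rewrite RintegralD// RintegralD// near_mass_translate.
have := near_mass_translate d (- a); under eq_Rintegral do rewrite opprK.
move=> ->; apply: lerD => //; rewrite ler_wpM2l//; last exact: lerD.
by rewrite mulr_ge0// ltW.
Qed.

End conjugate_inversion.

Section conjugate_involution.
Context {R : realType}.
Variables (u : R -> R) (M a : R).
Hypothesis mu : measurable_fun setT u.
Hypothesis uM : forall s, `|u s| <= M.
Hypothesis u_mean0 : \int[angle_law]_s u s = 0.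
Hypothesis u_locally_constant :
  forall e t s, away a e t -> far e (t - s) = 0 -> u s = u t.

Implicit Types (e d t s : R).

Let M0 : 0 <= M. Proof. exact: le_trans (uM 0). Qed.

Let ui : angle_law.-integrable setT (EFin \o u).
Proof. exact: (@integ_bounded _ _ _ angle_law u M mu uM). Qed.

Let su : square_integrable angle_law u.
Proof. exact: (@square_integrable_bounded _ _ _ angle_law u M mu uM). Qed.

Let constant_ge0 (eta : R) : 0 <= 1 + 8 / eta ^+ 2.
Proof. exact: addr_ge0 ler01 (divr_ge0 (ler0n _ _) (sqr_ge0 _)). Qed.

(** Constants are invisible to H_d, so u may be replaced by w = u - u t; its integral is - u t
    because u has mean zero. With c the composed kernel, the sum is the integral of w (c - 1): w
    vanishes within distance eta of t, and beyond it c is close to 1. *)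
Lemma conjugate_conjugate eta e d t : 0 < e -> e <= eta / 2 ->
  0 < d -> d <= eta / 2 -> away a eta t ->
  `|conjugate e (conjugate d u) t + u t| <=
  2 * M * ((1 + 8 / eta ^+ 2) * (near_mass e + near_mass d)).
Proof.
move=> e0 ee d0 de etat.
pose w y := u y - u t; pose g s := cot_kernel e (t - s).
have mw : measurable_fun setT w by exact: measurable_funB.
have wM y : `|w y| <= 2 * M.
  by apply: (le_trans (ler_normB _ _)); rewrite mulr_natl mulr2n lerD.
have wi : angle_law.-integrable setT (EFin \o w).
  exact: (@integ_bounded _ _ _ angle_law w (2 * M) mw wM).
have gi : angle_law.-integrable setT (EFin \o g) by exact: integ_cot_kernel.
have mB := measurable_cot_conv d.
have BC z : `|cot_conv d z| <= 2 / d by exact: cot_kernel_bounded.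
have conj_w s : conjugate d u s = \int[angle_law]_y (cot_conv d (s, y) * w y).
  rewrite /conjugate; under [RHS]eq_Rintegral do rewrite /w mulrBr.
  rewrite RintegralB//; last 2 first.
  - exact: (integ_kernel mB BC).
  - exact: (integ_kernel mB BC s (integ_cst angle_law (u t))).
  rewrite RintegralZr//; last exact: integ_cot_kernel.
  by rewrite [X in X * _]Rintegral_cot_kernel// mul0r subr0.
pose c y := \int[angle_law]_s (cot_conv d (s, y) * g s).
have E : conjugate e (conjugate d u) t = \int[angle_law]_y (w y * c y).
  rewrite -(integral_operator_duality mB BC gi wi).
  by apply: eq_Rintegral => s _; rewrite conj_w.
have wci : angle_law.-integrable setT (EFin \o (fun y => w y * c y)).
  have := integ_operatorM (swap_measurable mB) (fun z => BC (z.2, z.1)) wi gi.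
  by [].
have ut : u t = - \int[angle_law]_y w y.
  rewrite (RintegralB measurableT ui (integ_cst angle_law (u t))) u_mean0.
  by rewrite probability_Rintegral_cst sub0r opprK.
rewrite {1}E ut -(RintegralB measurableT wci wi).
apply: le_norm_Rintegral; first exact: integB wci wi.
move=> y; have -> : w y * c y - w y = w y * (c y - 1) by ring.
have K0 : 0 <= (1 + 8 / eta ^+ 2) * (near_mass e + near_mass d).
  apply: mulr_ge0 (constant_ge0 _) _.
  exact: addr_ge0 (near_mass_ge0 _) (near_mass_ge0 _).
have [fy|fy] := eqVneq (far eta (t - y)) 0.
  rewrite /w (u_locally_constant etat fy) subrr mul0r normr0.
  exact: mulr_ge0 (mulr_ge0 (ler0n _ _) M0) K0.
rewrite normrM; apply: ler_pM (normr_ge0 _) (normr_ge0 _) (wM y) _.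
exact: cot_kernel_composition.
Qed.

Let V := \int[angle_law]_t u t ^+ 2.
Local Notation L := (conjugate_limit u a).

(** Here e is fixed and d tends to 0 in H_e L = H_e (L - H_d u) + H_e H_d u. The first term is at
    most 2 / e times an L1 distance. *)
Lemma conjugate_conjugate_limit eta e t : 0 < e -> e <= eta / 2 -> away a eta t ->
  `|conjugate e L t + u t| <= 2 * M * (1 + 8 / eta ^+ 2) * near_mass e.
Proof.
move=> e0 ee etat; apply/ler_addgt0Pr => r r0.
have V0 : 0 <= V by apply: Rintegral_ge0 => s _; exact: sqr_ge0.
have eta0 : 0 < eta by lra.
set K := 2 * M * (1 + 8 / eta ^+ 2).
have K0 : 0 <= K.
  exact: mulr_ge0 (mulr_ge0 (ler0n _ _) M0) (constant_ge0 _).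
(* Chosen so that (2 / e) (4 V lam) = (r / 2) V / (V + 1), at most r / 2. *)
pose lam := r * e / (16 * (V + 1)).
have lam0 : 0 < lam by rewrite divr_gt0 ?mulr_gt0// ltr_wpDl.
have q0 : 0 < (e * lam)^-1 + K + 1.
  by rewrite ltr_wpDl// addr_ge0// invr_ge0 ltW// mulr_gt0.
(* The remaining terms are [near_mass d] times 1 / (e lam) + K; a small d makes them at most r /
   2. *)
have rq0 : 0 < r / 2 / ((e * lam)^-1 + K + 1) by rewrite !divr_gt0.
have [d0 d00 Hd] := near_mass_small rq0.
pose d := Num.min d0 (eta / 2).
have d_gt0 : 0 < d by rewrite lt_min d00 divr_gt0.
have d_eta : d <= eta / 2 by rewrite ge_min lexx orbT.
have := Hd d (ltW d_gt0); rewrite ge_min lexx => /(_ isT) small_d.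
have [sL _] := conjugate_limit_square mu uM u_locally_constant.
have sc := square_integrable_conjugate mu uM d_gt0.
have Li := square_integrable_integ sL; have ci := square_integrable_integ sc.
have mB := measurable_cot_conv e.
have BC z : `|cot_conv e z| <= 2 / e by exact: cot_kernel_bounded.
have split_ : conjugate e L t + u t =
  \int[angle_law]_s (cot_conv e (t, s) * (L s - conjugate d u s)) +
  (conjugate e (conjugate d u) t + u t).
  rewrite addrA; congr (_ + _); rewrite /conjugate.
  under [X in _ = X + _]eq_Rintegral do rewrite mulrBr.
  by rewrite RintegralB ?subrK//; exact: (integ_kernel mB BC).
rewrite split_; apply: (le_trans (ler_normD _ _)).
have A1 := le_norm_integral_operator mB BC t (integB Li ci).
have A2 := conjugate_limit_L1 mu uM u_locally_constant d_gt0 lam0.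
have A3 := conjugate_conjugate e0 ee d_gt0 d_eta etat.
have e2 : 0 < 2 / e by rewrite divr_gt0.
have A4 : 2 / e * (4 * V * lam + near_mass d / (2 * lam)) <=
    r / 2 + (e * lam)^-1 * near_mass d.
  rewrite mulrDr; apply: lerD.
    have -> : 2 / e * (4 * V * lam) = r / 2 * (V / (V + 1)).
      by rewrite /lam; field; rewrite !gt_eqF// ltr_wpDl.
    rewrite ler_piMr//; first by rewrite ltW// divr_gt0.
    by rewrite ler_pdivrMr ?ltr_wpDl// mul1r lerDl.
  rewrite le_eqVlt; apply/orP; left; apply/eqP.
  by field; rewrite !gt_eqF.
have A5 : near_mass d * ((e * lam)^-1 + K + 1) <= r / 2.
  by rewrite -ler_pdivlMr// ltW.
have nd0 := near_mass_ge0 d.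
apply: (le_trans (lerD A1 A3)).
have A6 := ler_wpM2l (ltW e2) A2.
have -> : 2 * M * ((1 + 8 / eta ^+ 2) * (near_mass e + near_mass d)) =
  K * near_mass e + K * near_mass d by rewrite /K; ring.
move: (A6) A4 A5; rewrite -/V; move: (2 / e * _) (2 / e * _) => x y xy yr.
rewrite !mulrDr mulr1 !(mulrC (near_mass d)) => A5.
move: (e * lam)^-1 => z in yr A5 *; lra.
Qed.

Lemma conjugate_involution eta t : 0 < eta -> away a eta t ->
  conjugate e L t @[e --> 0^'+] --> - u t.
Proof.
move=> eta0 etat; apply/cvgrPdist_lt => r r0.
pose K := 2 * M * (1 + 8 / eta ^+ 2) + 1.
have K0 : 0 < K.
  apply: ltr_wpDl => //.
  exact: mulr_ge0 (mulr_ge0 (ler0n _ _) M0) (constant_ge0 _).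
have [e0 e00 He] := near_mass_small (divr_gt0 r0 K0).
near=> e.
have e_gt0 : 0 < e by near: e; exact: nbhs_right_gt.
have e_eta : e <= eta / 2 by near: e; apply: nbhs_right_le; rewrite divr_gt0.
have ee0 : e <= e0 by near: e; exact: nbhs_right_le.
rewrite distrC opprK; apply: (le_lt_trans (conjugate_conjugate_limit e_gt0 e_eta etat)).
have := He e (ltW e_gt0) ee0; rewrite ltr_pdivlMr// => H.
apply: le_lt_trans H; rewrite mulrC ler_wpM2l ?near_mass_ge0// /K lerDl.
exact: ler01.
Unshelve. all: by end_near. Qed.

End conjugate_involution.

(** * The extremal function *)

Section circle_angle.
Context {R : realType}.

Lemma circle_Re_itv (xi : circle R) : -1 <= complex.Re (sval xi) <= 1.
Proof.
case: xi => [[x y] /= /eqP]; rewrite normc_def /= => /(congr1 (fun z => complex.Re z)) /= h.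
have : x ^+ 2 + y ^+ 2 = 1.
  by rewrite -[LHS]sqr_sqrtr ?addr_ge0 ?sqr_ge0// h expr1n.
by have := sqr_ge0 y => y0 E; apply/andP; split; nra.
Qed.

(** A formula for the inverse of [expi] on ]-pi, pi] that is visibly measurable, whereas [arg] comes
    from a choice. *)
Definition angle (xi : circle R) : R :=
  if 0 <= complex.Im (sval xi) then acos (complex.Re (sval xi))
  else - acos (complex.Re (sval xi)).

Lemma angle_expi (t : R) : t \in `]- pi, pi] -> angle (expi t) = t.
Proof.
rewrite in_itv/= /angle /= => /andP[t1 t2]; case: ifPn => st.
  rewrite cosK// in_itv/= t2 andbT leNgt; apply/negP => t0.
  have : 0 < sin (- t) by apply: sin_gt0_pi; apply/andP; split; lra.
  by rewrite sinN oppr_gt0 ltNge st.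
rewrite cosKN ?opprK// ltW//= leNgt; apply/negP => t0.
have [tE|tpi] := eqVneq t pi; first by move: st; rewrite tE sinpi lexx.
by move: st; rewrite ltW// sin_gt0_pi// t0 lt_neqAle tpi.
Qed.

Lemma measurable_circle_coord : measurable_fun setT (@circle_coord R).
Proof. by move=> _ B mB; exists B. Qed.

(** Continuity settles the open interval; the two endpoints are split off as singletons. *)
Lemma measurable_acos : measurable_fun (`[-1, 1]%classic : set R) (@acos R).
Proof.
have -> : `[-1, 1]%classic = [set -1; 1] `|` `]-1, 1[ :> set R.
  apply/seteqP; split => x /=; rewrite !in_itv/=.
    move=> /andP[x1 x2]; have [->|n1] := eqVneq x (-1); first by left; left.
    have [->|n2] := eqVneq x 1; first by left; right.
    by right; rewrite lt_neqAle eq_sym n1 x1 lt_neqAle n2.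
  by move=> [[->|->]|/andP[x1 x2]]; apply/andP; split; lra.
apply/measurable_funU; [|by []|split].
- by apply: measurableU; exact: measurable_set1.
- apply/measurable_funU; [exact: measurable_set1|exact: measurable_set1|].
  by split; exact: measurable_fun_set1.
- apply: open_continuous_measurable_fun; first exact: itv_open.
  by move=> x; rewrite inE/= in_itv/= => x1; exact: continuous_acos.
Qed.

Lemma measurable_angle : measurable_fun setT angle.
Proof.
have mre : measurable_fun setT (fun xi : circle R => complex.Re (sval xi)).
  exact: (measurableT_comp measurable_fst measurable_circle_coord).
have mim : measurable_fun setT (fun xi : circle R => complex.Im (sval xi)).
  exact: (measurableT_comp measurable_snd measurable_circle_coord).
have mac : measurable_fun setT (fun xi : circle R => acos (complex.Re (sval xi))).
  apply: (measurable_comp (F := `[-1, 1]%classic : set R) _ _ measurable_acos mre) => //.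
  by move=> _ [xi _ <-] /=; rewrite in_itv/=; exact: circle_Re_itv.
apply: measurable_fun_ifT => //.
  exact: measurable_fun_ler.
exact: measurableT_comp.
Qed.

End circle_angle.

(** * The two-valued function with jumps at alpha and - alpha *)

Section two_valued.
Context {R : realType}.
Variable m : R.
Hypothesis m01 : 0 <= m < 1.

(** Half the opening of an arc of normalized length m, centred at angle 0. *)
Local Notation alpha := (pi * m).

Let m0 : 0 <= m. Proof. by case/andP: m01. Qed.
Let m1 : m < 1. Proof. by case/andP: m01. Qed.

Let alpha_itv : 0 <= alpha < pi.
Proof. by rewrite mulr_ge0 ?pi_ge0//= gtr_pMr ?pi_gt0. Qed.

(* Equality in Cantelli's inequality forces this two-valued distribution. *)
Definition two_valued (t : R) : R := if cos alpha < cos t then 1 else - (m / (1 - m)).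

Let ratio0 : 0 <= m / (1 - m).
Proof. by rewrite divr_ge0// subr_ge0 ltW. Qed.

Lemma measurable_two_valued : measurable_fun setT two_valued.
Proof.
apply: measurable_fun_ifT => //; apply: measurable_fun_ltr => //.
by apply: continuous_measurable_fun; exact: continuous_cos.
Qed.

Lemma two_valued_bounded t : `|two_valued t| <= 1 + m / (1 - m).
Proof.
rewrite /two_valued; case: ifP => _; first by rewrite normr1 lerDl.
by rewrite normrN ger0_norm// lerDr.
Qed.

Lemma cos_gt_alpha t : t \in `]- pi, pi] -> (cos alpha < cos t) = (`|t| < alpha).
Proof.
rewrite in_itv/= => /andP[t1 t2]; have /andP[a0 api] := alpha_itv.
have -> : cos t = cos `|t| by have [t0|t0] := leP 0 t; [rewrite ger0_norm|rewrite ltr0_norm// cosN].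
apply: ltr_cos; rewrite in_itv/= ?normr_ge0 ?a0 ?(ltW api)//=.
by rewrite ler_norml (ltW t1).
Qed.

Let arc : set (measurableTypeR R) := [set t | cos alpha < cos t].

Lemma measurable_arc : measurable arc.
Proof.
have mc : measurable_fun setT (@cos R).
  by apply: continuous_measurable_fun; exact: continuous_cos.
rewrite -[arc]setTI; exact: (measurable_fun_ltr (measurable_cst (cos alpha)) mc measurableT).
Qed.

Let marc : measurable arc := measurable_arc.

Lemma angle_law_arc : angle_law arc = m%:E.
Proof.
have /andP[a0 api] := alpha_itv; have pi0 := pi_gt0 R.
have itvE : angle_law `]- alpha, alpha[%classic = m%:E.
  rewrite angle_law_itv; [|lra|lra|lra].
  by congr EFin; move: (pi : R) pi0 => p p0; field; exact: lt0r_neq0.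
rewrite -itvE; apply/eqP; rewrite eq_le; apply/andP; split; apply: le_angle_law => t [].
  by rewrite /arc/= in_itv/= => + tI; rewrite cos_gt_alpha// ltr_norml.
by move=> + tI; rewrite /= in_itv/= /arc/= cos_gt_alpha// ltr_norml.
Qed.

Lemma two_valuedE t : two_valued t = (1 + m / (1 - m)) * \1_arc t - m / (1 - m).
Proof.
rewrite /two_valued indicE; case: ifPn => ct.
  by rewrite mem_set// mulr1 addrK.
by rewrite memNset ?mulr0 ?sub0r//; exact/negP.
Qed.

Let arc_indic : \int[angle_law]_t \1_arc t = m.
Proof.
rewrite /Rintegral integral_indic// setIT.
exact: (congr1 fine angle_law_arc).
Qed.

Let iarc : angle_law.-integrable setT (EFin \o (\1_arc : _ -> R)).
Proof. exact: integrable_indic. Qed.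

Let m1N0 : 1 - m != 0. Proof. by rewrite gt_eqF// subr_gt0. Qed.

Lemma two_valued_mean0 : \int[angle_law]_t two_valued t = 0.
Proof.
under eq_Rintegral do rewrite two_valuedE.
rewrite RintegralB//; [|exact: integZ|exact: integ_cst].
rewrite RintegralZl// arc_indic probability_Rintegral_cst.
by field.
Qed.

Lemma two_valued_square : \int[angle_law]_t two_valued t ^+ 2 = m / (1 - m).
Proof.
pose c := (1 - (m / (1 - m)) ^+ 2); pose b := (m / (1 - m)) ^+ 2.
transitivity (\int[angle_law]_t (c * \1_arc t + b)).
  apply: eq_Rintegral => t _; rewrite /two_valued indicE; case: ifPn => ct.
    by rewrite mem_set// mulr1 /c /b subrK expr1n.
  by rewrite memNset ?mulr0 ?add0r ?sqrrN//; exact/negP.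
rewrite RintegralD//; [|exact: integZ|exact: integ_cst].
rewrite RintegralZl// arc_indic probability_Rintegral_cst /c /b.
by field.
Qed.

Let ler_cos : {in `[0, pi] &, {mono (@cos R) : x y /~ x <= y}}.
Proof. by move=> x y xI yI; rewrite !leNgt ltr_cos. Qed.

Let sin_acos_cos (x : R) : sin (acos (cos x)) = `|sin x|.
Proof.
rewrite sin_acos ?cos_geN1 ?cos_le1// -sqrtr_sqr; congr Num.sqrt.
by rewrite -(cos2Dsin2 x) addrC addKr.
Qed.

(* For x and y in different arcs cut out by the angles alpha and - alpha, the
   right-hand sides are the maxima of cos (y -+ alpha) and cos (x -+ alpha). *)
Let separation (x y : R) : cos x <= cos alpha -> cos alpha < cos y ->
  cos (x - y) <= cos y * cos alpha + `|sin y| * sin alpha /\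
  cos (x - y) <= cos x * cos alpha + `|sin x| * sin alpha.
Proof.
have /andP[a0 api] := alpha_itv.
have cosI (z : R) : -1 <= cos z <= 1 by rewrite cos_geN1 cos_le1.
(* Folding both angles into [0, pi] can only bring them closer. There q < alpha <= p, and alpha - q
   and p - alpha are both at most p - q. *)
pose p := acos (cos x); pose q := acos (cos y).
have p0 : 0 <= p by exact: acos_ge0.
have p1 : p <= pi by exact: acos_lepi.
have q0 : 0 <= q by exact: acos_ge0.
have q1 : q <= pi by exact: acos_lepi.
have cp : cos p = cos x by rewrite acosK// in_itv/=.
have cq : cos q = cos y by rewrite acosK// in_itv/=.
rewrite -{1}cp -{1}cq ltr_cos ?in_itv/= ?q0 ?a0 ?(ltW api)// ler_cos ?in_itv/= ?p0 ?a0 ?(ltW api)//.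
move=> ap qa.
have xy : cos (x - y) <= cos (p - q).
  rewrite !cosB cp cq !sin_acos_cos lerD2l -normrM; exact: ler_norm.
split; apply: (le_trans xy).
  have -> : cos y * cos alpha + `|sin y| * sin alpha = cos (alpha - q).
    by rewrite cosB cq sin_acos_cos; ring.
  by rewrite ler_cos ?in_itv/=; [lra|apply/andP; split; lra|apply/andP; split; lra].
have -> : cos x * cos alpha + `|sin x| * sin alpha = cos (p - alpha).
  by rewrite cosB cp sin_acos_cos; ring.
by rewrite ler_cos ?in_itv/=; [lra|apply/andP; split; lra|apply/andP; split; lra].
Qed.

(** A point on the other arc is no closer to t than the nearer of the two jumps, and both jumps are
    farther than e. *)
Lemma two_valued_locally_constant e t s : away alpha e t -> far e (t - s) = 0 ->
  two_valued s = two_valued t.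
Proof.
move=> /andP[]; rewrite !far_neq0E => f1 f2 /eqP.
rewrite -[_ == 0]negbK far_neq0E -leNgt => ts.
have side : cos (t - s) <= cos t * cos alpha + `|sin t| * sin alpha -> False.
  rewrite cosB in f1; rewrite cosD in f2 => H.
  have [st|st] := leP 0 (sin t).
    by move: H; rewrite ger0_norm//; lra.
  by move: H; rewrite ltr0_norm//; lra.
rewrite /two_valued; case: ifPn => cs; case: ifPn => ct //; exfalso; apply: side.
  by rewrite -leNgt in ct; have [] := separation ct cs.
rewrite -leNgt in cs; have [+ _] := separation cs ct.
by rewrite -cosN opprB.
Qed.

End two_valued.

Section extremal_function.
Context {R : realType}.
Variable m : R.
Hypothesis m01 : 0 <= m < 1.

Local Notation alpha := (pi * m).
Local Notation u := (two_valued m).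
Local Notation L := (conjugate_limit u alpha).

Let mu := measurable_two_valued m.
Let uM := two_valued_bounded m01.
Let u0 := two_valued_mean0 m01.
Let u_lc := @two_valued_locally_constant _ _ m01.

Let alpha_itv : 0 <= alpha < pi.
Proof.
by have /andP[m0 m1] := m01; rewrite mulr_ge0 ?pi_ge0//= gtr_pMr ?pi_gt0.
Qed.

Definition extremal (xi : circle R) : R := - L (angle xi).

Let mL : measurable_fun setT L.
Proof. exact: measurable_conjugate_limit mu uM u_lc. Qed.

Lemma measurable_extremal : measurable_fun setT extremal.
Proof.
exact: (measurableT_comp (@oppr_measurable _ _)
  (measurableT_comp mL measurable_angle)).
Qed.

Lemma extremal_expi t : t \in `[- pi, pi] -> extremal (expi t) = - L t.
Proof.
rewrite in_itv/= => /andP[t1 t2]; rewrite /extremal.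
(* The angles - pi and pi give the same point, whose [angle] is pi; periodicity of the limit covers
   the other endpoint. *)
have [->|tpi] := eqVneq t (- pi); last first.
  by rewrite angle_expi// in_itv/= t2 andbT lt_neqAle eq_sym tpi.
have -> : expi (- pi) = expi pi :> circle R.
  by apply/val_inj; rewrite /= cosN sinN sinpi oppr0.
rewrite (@angle_expi _ pi); last by rewrite in_itv/= lexx andbT gtrN// pi_gt0.
have <- := @periodic_conjugate_limit _ u alpha (- pi).
by rewrite mulr2n addrA addNr add0r.
Qed.

Lemma conjugate_extremal e t : 0 < e ->
  conjugate e (extremal \o @expi R) t = - conjugate e L t.
Proof.
move=> e0; have [sL _] := conjugate_limit_square mu uM u_lc.
have Li := square_integrable_integ sL.
have mk : measurable_fun setT (fun s : R => cot_kernel e (t - s)).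
  exact: measurable_reflect (measurable_cot_kernel e).
have BC z : `|cot_conv e z| <= 2 / e by exact: cot_kernel_bounded.
rewrite -mulN1r /conjugate -RintegralZl//; last first.
  exact: (integ_kernel (measurable_cot_conv e) BC).
rewrite !Rintegral_angle_law.
- congr (_ * _); apply: eq_Rintegral => s; rewrite inE => sI.
  by rewrite /= extremal_expi// mulN1r mulrN.
- by apply: measurable_funM => //; exact: measurable_funM.
- by apply: measurable_funM => //; exact: measurable_comp_expi measurable_extremal.
Qed.

Lemma haar_square_extremal :
  (\int[@haar R]_xi (extremal xi ^+ 2)%:E = \int[angle_law]_t (L t ^+ 2)%:E)%E.
Proof.
have mf := measurable_extremal.
rewrite integral_haar; last 2 first.
- by apply/measurable_EFinP; exact: measurable_funX.
- by move=> xi; rewrite lee_fin sqr_ge0.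
rewrite !ge0_integral_angle_law//.
- congr (_ * _)%E; apply: eq_integral => t; rewrite inE/= in_itv/= => /andP[t1 t2].
  by rewrite extremal_expi ?sqrrN// in_itv/= (ltW t1).
- by apply/measurable_EFinP; exact: measurable_funX.
- by move=> t; rewrite lee_fin sqr_ge0.
- by apply/measurable_EFinP; apply: measurable_funX; exact: measurable_comp_expi.
- by move=> t; rewrite lee_fin sqr_ge0.
Qed.

Lemma extremal_Lfun : extremal \in Lfun (@haar R) 2%:E.
Proof.
apply/andP; split; rewrite inE; first exact: measurable_extremal.
rewrite /= /finite_norm unlock /=; apply: poweR_lty.
rewrite (_ : (\int[_]_x _)%E = \int[angle_law]_t (L t ^+ 2)%:E)%E; last first.
  rewrite -haar_square_extremal; apply: eq_integral => xi _.
  by rewrite /= ?poweR_EFin powR_mulrn// real_normK// num_real.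
have [[_ /integrableP[_ +]] _] := conjugate_limit_square mu uM u_lc.
by under eq_integral do rewrite gee0_abs ?lee_fin ?sqr_ge0//=.
Qed.

Lemma L2norm_extremal_le : L2norm extremal ^+ 2 <= m / (1 - m).
Proof.
have [sF <-] := Lfun_haar_square extremal_Lfun.
rewrite -(two_valued_square m01).
have [_ +] := conjugate_limit_square mu uM u_lc; apply: le_trans.
rewrite le_eqVlt; apply/orP; left; apply/eqP.
rewrite /Rintegral; congr fine; rewrite -haar_square_extremal.
rewrite integral_haar//.
- by apply/measurable_EFinP; exact: measurable_funX measurable_extremal.
- by move=> xi; rewrite lee_fin sqr_ge0.
Qed.

Lemma hilbert_extremal t : t \in `]- pi, pi] -> t != alpha -> t != - alpha ->
  hilbert extremal (expi t) = u t.
Proof.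
move=> tI ta tNa; have /andP[a0 api] := alpha_itv.
have /andP[t1 t2] : - pi < t <= pi by move: tI; rewrite in_itv.
have away_cos (b : R) : `|b| < pi -> t != b -> cos (t - b) < 1.
  rewrite ltr_norml => /andP[b1 b2] tb; rewrite lt_neqAle cos_le1 andbT.
  apply: contra_neq tb => /cos_eq1_small tb; apply/eqP; rewrite -subr_eq0.
  by rewrite tb// ltr_norml mulr2n; apply/andP; split; lra.
have c1 : cos (t - alpha) < 1 by apply: away_cos => //; rewrite ger0_norm.
have c2 : cos (t + alpha) < 1.
  by have := away_cos (- alpha); rewrite opprK; apply => //; rewrite normrN ger0_norm.
have [n _ /(_ n (leqnn n)) [f1 f2]] :=
  filterI (far_harmonic c1) (far_harmonic c2).
have et : away alpha (harmonic n) t by apply/andP.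
apply/cvg_lim => //.
have := conjugate_involution mu uM u0 u_lc (harmonic_gt0 n) et.
move=> /cvgN; rewrite opprK; apply: cvg_trans; apply: near_eq_cvg.
near=> e; have e0 : 0 < e by near: e; exact: nbhs_right_gt.
by rewrite truncated_hilbertE ?conjugate_extremal//; exact: measurable_extremal.
Unshelve. all: by end_near. Qed.

(** The transform is computed off the angles alpha and - alpha only, so the level set is squeezed
    between the arc and the arc with these two null points added. *)
Lemma haar_hilbert_extremal : haar [set xi | 1 <= hilbert extremal xi] = m%:E.
Proof.
have /andP[m0 m1] := m01; have /andP[a0 api] := alpha_itv.
have r0 : 0 <= m / (1 - m) by rewrite divr_ge0// subr_ge0 ltW.
have ms (b : R) : measurable ([set b] : set (measurableTypeR R)).
  exact: measurable_set1.
have marc := measurable_arc m.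
rewrite haarE; apply/eqP; rewrite eq_le -{1 2}(angle_law_arc m01).
apply/andP; split.
  apply: (@le_trans _ _ (angle_law ([set t | cos alpha < cos t] `|` [set alpha]
      `|` [set - alpha]))).
    apply: le_angle_law => t [St tI].
    have [->|ta] := eqVneq t alpha; first by left; right.
    have [->|tNa] := eqVneq t (- alpha); first by right.
    left; left; move: St; rewrite /= hilbert_extremal// /two_valued.
    by case: ifP => // _; lra.
  apply: (le_trans (measureU2 _ (measurableU _ _ marc (ms _)) (ms _))).
  rewrite [X in (_ + X)%E]angle_law_set1 adde0.
  apply: (le_trans (measureU2 _ marc (ms _))).
  by rewrite [X in (_ + X)%E]angle_law_set1 adde0.
apply: le_angle_law => t [/= ct tI].
have := ct; rewrite cos_gt_alpha// => ta.
rewrite hilbert_extremal//.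
- by rewrite /two_valued ct.
- by apply: contraTneq ta => ->; rewrite ger0_norm// ltxx.
- by apply: contraTneq ta => ->; rewrite normrN ger0_norm// ltxx.
Qed.

(* The lower bound on the norm is the inequality already proved for all
   functions, applied to [extremal]. *)
Lemma L2norm_extremal :
  L2norm extremal ^+ 2 / (1 + L2norm extremal ^+ 2) = m.
Proof.
have /andP[m0 m1] := m01.
have := haar_hilbert_le extremal_Lfun; rewrite haar_hilbert_extremal lee_fin => lo.
have := L2norm_extremal_le; have := sqr_ge0 (L2norm extremal).
move: (_ ^+ 2) lo => N lo N0; rewrite ler_pdivlMr ?subr_gt0// => up.
apply/eqP; rewrite eq_le lo andbT ler_pdivrMr ?ltr_wpDr//; lra.
Qed.

End extremal_function.

Theorem corollary1p4 (R : realType) :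
  (forall f : circle R -> R, f \in Lfun (@haar R) 2%:E ->
    (((2 * pi)^-1)%:E * arclength [set xi | (1 <= hilbert f xi)%R]
      <= (L2norm f ^+ 2 / (1 + L2norm f ^+ 2))%:E)%E) /\
  (forall m : R, 0 <= m < 1 ->
    exists f : circle R -> R,
      [/\ f \in Lfun (@haar R) 2%:E,
          (((2 * pi)^-1)%:E * arclength [set xi | (1 <= hilbert f xi)%R])%E = m%:E
        & L2norm f ^+ 2 / (1 + L2norm f ^+ 2) = m]).
Proof.
split; first exact: haar_hilbert_le.
move=> m m01; exists (extremal m); split.
- exact: extremal_Lfun.
- exact: haar_hilbert_extremal.
- exact: L2norm_extremal.
Qed.
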